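(* Let $f(x)=\mathbb{E}_{Z\sim\pi}[F(x,Z)]$ be $L$-smooth on $\mathbb{R}^d$ (not necessarily convex) with a global minimum value $f^*$. Assume $\{Z_i\}$ is a stationary Markov chain with kernel $\mathrm{Q}$, unique invariant distribution $\pi$ and $\sup_{z,z'}\frac12\|\mathrm{Q}^k(z,\cdot)-\mathrm{Q}^k(z',\cdot)\|_{\mathsf{TV}}\le(1/4)^{\lfloor k/\tau\rfloor}$ for all $k\in\mathbb{N}$, and $\mathbb{E}_\pi[\nabla F(x,Z)]=\nabla f(x)$, $\|\nabla F(x,z)-\nabla f(x)\|^2\le\sigma^2+\delta^2\|\nabla f(x)\|^2$ for all $x,z$. Run Randomized GD (see context) with any $b\in\mathbb{N}^*$ and $\gamma,M,B$ satisfying $$\gamma\le\Big[4L\Big(1+4\big[C_1\tau b^{-1}+(C_1+1)\tau^2b^{-2}\big]\delta^2\Big)\Big]^{-1},\quad M=\max\{2;\sqrt{C_2\gamma^{-1}L^{-1}}\},\quad B=\lceil b\log_2M\rceil,$$ where $C_1=16(1+1/\ln^24)$, $C_2=256/3$. Then there is an absolute constant $C>0$ such that $$\mathbb{E}\Big[\frac1N\sum_{k=0}^{N-1}\|\nabla f(x^k)\|^2\Big]\le C\Big(\frac{f(x^0)-f^*}{\gamma N}+L\gamma\big[\sigma^2\tau b^{-1}+\sigma^2\tau^2b^{-2}\big]\Big).$$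
   Context: Randomized GD: parameters $\gamma>0$, number of iterations $N$, batch limit $M$, base batch size $B$; initialization $x^0$, $T^0=0$. For $k=0,\dots,N-1$: sample $J_k\sim\mathrm{Geom}(1/2)$ ($\mathbb{P}(J_k=j)=2^{-j}$, $j\ge1$); $g^k_j=2^{-j}B^{-1}\sum_{i=1}^{2^jB}\nabla F(x^k,Z_{T^k+i})$; $g^k=g^k_0+2^{J_k}(g^k_{J_k}-g^k_{J_k-1})$ if $2^{J_k}\le M$, else $g^k=g^k_0$; $x^{k+1}=x^k-\gamma g^k$; $T^{k+1}=T^k+2^{J_k}B$. $\tau\in\mathbb{N}$ is the mixing time, $\|\cdot\|_{\mathsf{TV}}$ the total variation norm. *)

(* Defs.v *)
From HB Require Import structures.
From mathcomp Require Import all_boot all_order all_algebra.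
From mathcomp Require Import all_classical all_reals all_analysis.
Set Implicit Arguments. Unset Strict Implicit. Unset Printing Implicit Defensive.
Import Order.TTheory GRing.Theory Num.Theory.
Import numFieldNormedType.Exports.
Local Open Scope classical_set_scope.
Local Open Scope ring_scope.

Section RGD.
Variable R : realType.

Definition dotv (d : nat) (u v : 'rV[R]_d) : R := \sum_(i < d) u 0 i * v 0 i.
Definition sqnorm (d : nat) (v : 'rV[R]_d) : R := dotv v v.
Definition enorm (d : nat) (v : 'rV[R]_d) : R := Num.sqrt (sqnorm v).

Definition is_gradient (d : nat) (f : 'rV[R]_d -> R) (x g : 'rV[R]_d) : Prop :=
  differentiable f x /\ forall v, ('d f x : 'rV[R]_d -> R) v = dotv g v.

Definition L_smooth (d : nat) (f : 'rV[R]_d -> R) (gradf : 'rV[R]_d -> 'rV[R]_d)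
  (L : R) : Prop :=
  (forall x, is_gradient f x (gradf x)) /\
  (forall x y, enorm (gradf x - gradf y) <= L * enorm (x - y)).

Section Kernel.
Context (dS : measure_display) (S : measurableType dS).

Fixpoint Qpow (Q : R.-pker S ~> S) (k : nat) (z : S) (A : set S) : \bar R :=
  match k with
  | 0 => ((\1_A z : R))%:E
  | k'.+1 => \int[Q z]_y Qpow Q k' y A
  end.

(* ktail Q A n i z = P_z(Z_{i+1} \in A (i+1), ..., Z_{i+n} \in A (i+n)) for a
   chain with kernel Q started at time i at z *)
Fixpoint ktail (Q : R.-pker S ~> S) (A : nat -> set S) (n i : nat) (z : S)
  : \bar R :=
  match n with
  | 0 => 1%E
  | n'.+1 => \int[Q z]_y (((\1_(A i.+1) y : R))%:E * ktail Q A n' i.+1 y)%E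
  end.

Definition markov_fdd (pi : probability S R) (Q : R.-pker S ~> S)
  (A : nat -> set S) (n : nat) : \bar R :=
  \int[pi]_z (((\1_(A 0) z : R))%:E * ktail Q A n 0 z)%E.

Definition Q_invariant (Q : R.-pker S ~> S) (mu : probability S R) : Prop :=
  forall A, measurable A -> (mu A = \int[mu]_z Q z A)%E.

End Kernel.

Definition geom_half (j : nat) : R := if j == 0%N then 0 else (2^-1) ^+ j.

Section Algorithm.
Context (d : nat) (S : Type) (Omega : Type).
Variables (G : 'rV[R]_d -> S -> 'rV[R]_d) (Z : nat -> Omega -> S)
  (J : nat -> Omega -> nat) (gamma M : R) (B : nat) (x0 : 'rV[R]_d).

Definition gbatch (x : 'rV[R]_d) (T j : nat) (w : Omega) : 'rV[R]_d :=
  ((2 ^ j * B)%N%:R)^-1 *: \sum_(1 <= i < (2 ^ j * B).+1) G x (Z (T + i) w).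

Definition gest (k : nat) (x : 'rV[R]_d) (T : nat) (w : Omega) : 'rV[R]_d :=
  let j := J k w in
  if ((2 ^ j)%N%:R <= M) then
    gbatch x T 0 w + (2 ^ j)%N%:R *: (gbatch x T j w - gbatch x T j.-1 w)
  else gbatch x T 0 w.

Fixpoint rgd (k : nat) (w : Omega) : 'rV[R]_d * nat :=
  match k with
  | 0 => (x0, 0%N)
  | k'.+1 =>
      let xT := rgd k' w in
      (xT.1 - gamma *: gest k' xT.1 xT.2 w, (xT.2 + 2 ^ (J k' w) * B)%N)
  end.

End Algorithm.
End RGD.

(* Main.v *)
Require Import Defs.
From HB Require Import structures.
From mathcomp Require Import all_boot all_order all_algebra.
From mathcomp Require Import all_classical all_reals all_analysis.
From mathcomp Require Import measurable_realfun.
From mathcomp Require Import ring lra zify.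
Import Order.TTheory GRing.Theory Num.Theory.
Import numFieldNormedType.Exports.
Local Open Scope classical_set_scope.
Local Open Scope ring_scope.
Set Implicit Arguments.
Unset Strict Implicit.
Unset Printing Implicit Defensive.

(* On each event [J_0 = j_0, ..., J_(k-1) = j_(k-1)] the clock [T^k] is a
   constant [t] and [x^k] is a function of [Z_0, ..., Z_t], so that by
   independence of [J] and [Z] the analysis reduces to a chain [Z] with
   deterministic sampling times.  Since the noise is bounded by
   [s(x)^2 = sigma^2 + delta^2 |grad f(x)|^2] and has mean [0] under [pi], mixing
   gives [|E <v(Z_(t+i)), v(Z_(t+i+k))>| <= 2 * 4^-(k / tau) E s^2] for the
   noise [v]; summing the geometric series, an average over [n] samples has
   variance [O(tau / n) E s^2] and relative bias [O(tau / n)].  Averaging over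
   [J_k] telescopes the bias of the multilevel estimator to that of a batch of
   [2^m B >= M B / 2] samples, at the price of a variance [O(tau (m + 1) / B)].
   The descent lemma together with the choice of [M], [B] and [gamma] then gives
   [E f(x^(k+1)) <= E f(x^k) - (gamma / 4) E |grad f(x^k)|^2 + noise], which is
   summed over [k].  Every [x^k] stays in a deterministic ball, so that only
   bounded measurable functions are ever integrated. *)

(** * Bounded measurable functions and positive functionals on them *)

Section BoundedMeasurable.
Context {R : realType}.

(** The clock is random because [J_k] decides how many samples are consumed. Fixing all earlier
    levels replaces a filtration along random times by sigma-algebras of the past of [Z] at constant
    times. No conditional expectation is formed: the Markov property is an equality of integrals of
    functions of a past outcome and one later state. For a pair of samples in a batch, the past runs
    up to the earlier one and contains [x^k]; covariances therefore decay with the lag although the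
    dependence of [x^k] on the chain destroys stationarity. Let [2^m <= M < 2^(m+1)]. Each parameter
    pays for one error. [M] makes the squared relative bias at most [gamma L (tau / b)^2 / 3]: the
    bias is at most [(16 / 3) tau / (M b)], and [C_2 = 256 / 3] is exactly what this comparison
    needs. [B >= b log_2 M] absorbs the number of levels, as [(m + 1) / B <= 2 / b]. The bound on
    [gamma] absorbs the multiples of the squared gradient norm that come from [delta^2]. *)

Definition bmf d (T : measurableType d) (h : T -> R) : Prop :=
  measurable_fun setT h /\ exists c : R, forall x, `|h x| <= c.

Section Closure.
Context d (T : measurableType d).
Implicit Types f g h : T -> R.

Lemma bmf_cst c : bmf (fun _ : T => c).
Proof. by split; [exact: measurable_cst|exists `|c|]. Qed.

Lemma bmfD f g : bmf f -> bmf g -> bmf (fun x => f x + g x).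
Proof.
move=> [mf [c hc]] [mg [c' hc']]; split; first exact: measurable_funD.
by exists (c + c') => x; rewrite (le_trans (ler_normD _ _))// lerD.
Qed.

Lemma bmfM f g : bmf f -> bmf g -> bmf (fun x => f x * g x).
Proof.
move=> [mf [c hc]] [mg [c' hc']]; split; first exact: measurable_funM.
by exists (c * c') => x; rewrite normrM ler_pM.
Qed.

Lemma bmfZ a f : bmf f -> bmf (fun x => a * f x).
Proof. exact: bmfM (bmf_cst a). Qed.

Lemma bmfN f : bmf f -> bmf (fun x => - f x).
Proof.
by move=> bf; under eq_fun do rewrite -mulN1r; exact: bmfZ.
Qed.

Lemma bmfB f g : bmf f -> bmf g -> bmf (fun x => f x - g x).
Proof. by move=> bf bg; apply: bmfD => //; exact: bmfN. Qed.

Lemma bmf_sum (I : Type) (s : seq I) (h : I -> T -> R) :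
  (forall i, bmf (h i)) -> bmf (fun x => \sum_(i <- s) h i x).
Proof.
move=> bh; elim: s => [|i s IH].
  by under eq_fun do rewrite big_nil; exact: bmf_cst.
by under eq_fun do rewrite big_cons; exact: bmfD.
Qed.

Lemma bmf_indic (A : set T) : measurable A -> bmf (\1_A : T -> R).
Proof.
move=> mA; split; first exact: measurable_indic.
by exists 1 => x; rewrite indicE; case: (_ \in _); rewrite ?normr0 ?normr1.
Qed.

Lemma bmf_comp d' (T' : measurableType d') (phi : T' -> T) h :
  measurable_fun setT phi -> bmf h -> bmf (fun x => h (phi x)).
Proof.
move=> mphi [mh [c hc]]; split; first exact: measurableT_comp.
by exists c.
Qed.

Lemma bmf_integrable (mu : {measure set T -> \bar R}) D h :
  measurable D -> (mu setT < +oo)%E -> bmf h -> mu.-integrable D (EFin \o h).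
Proof.
move=> mD mufin [mh [c hc]]; apply: measurable_bounded_integrable => //.
- by apply: le_lt_trans mufin; apply: le_measure; rewrite ?inE.
- exact: measurable_funTS.
- exists c; split; first exact: num_real.
  by move=> c' cc' x _ /=; rewrite (le_trans (hc x))// ltW.
Qed.

End Closure.

(* Iterated integrals against a kernel are functionals of this kind, so that
   their uniqueness follows from a pi-system without product measures. *)
Record bint d (T : measurableType d) (lam : (T -> R) -> R) : Prop := Bint {
  bintD : forall f g, bmf f -> bmf g ->
    lam (fun x => f x + g x) = lam f + lam g;
  bintZ : forall a f, bmf f -> lam (fun x => a * f x) = a * lam f;
  bint_ge0 : forall f, bmf f -> (forall x, 0 <= f x) -> 0 <= lam f;
  bint_cvg : forall (u : (T -> R)^nat) f (c : R), (forall n, bmf (u n)) -> bmf f ->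
    (forall n x, `|u n x| <= c) -> (forall x, u ^~ x @ \oo --> f x) ->
    lam (u n) @[n --> \oo] --> lam f }.

Section BintTheory.
Context d (T : measurableType d).
Variable lam : (T -> R) -> R.
Hypothesis blam : bint lam.

Lemma bintB f g : bmf f -> bmf g -> lam (fun x => f x - g x) = lam f - lam g.
Proof.
move=> bf bg; rewrite bintD//; last exact: bmfN.
by under [fun x => - g x]eq_fun do rewrite -mulN1r; rewrite bintZ// mulN1r.
Qed.

Lemma bint_le f g : bmf f -> bmf g -> (forall x, f x <= g x) -> lam f <= lam g.
Proof.
move=> bf bg fg; rewrite -subr_ge0 -bintB//; apply: bint_ge0 => //.
- exact: bmfB.
- by move=> x; rewrite subr_ge0.
Qed.

Lemma bint_cst c : lam (fun _ => c) = c * lam (fun _ => 1).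
Proof.
rewrite -bintZ//; last exact: bmf_cst.
by congr lam; apply/funext => x; rewrite mulr1.
Qed.

Lemma bint_sum (I : Type) (s : seq I) (h : I -> T -> R) :
  (forall i, bmf (h i)) ->
  lam (fun x => \sum_(i <- s) h i x) = \sum_(i <- s) lam (h i).
Proof.
move=> bh; elim: s => [|i s IH].
  by rewrite big_nil; under eq_fun do rewrite big_nil; rewrite bint_cst mul0r.
rewrite big_cons -IH -bintD//; last exact: bmf_sum.
by congr lam; apply/funext => x; rewrite big_cons.
Qed.

Lemma bint_abs_le h c : bmf h -> (forall x, `|h x| <= c) ->
  `|lam h| <= c * lam (fun _ => 1).
Proof.
move=> bh hc; rewrite -bint_cst ler_norml; apply/andP; split.
  have := @bint_le (fun _ => - c) h (bmf_cst _ _) bh.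
  rewrite bint_cst mulNr -bint_cst; apply => x.
  by have := hc x; rewrite ler_norml => /andP[].
apply: bint_le => //; first exact: bmf_cst.
by move=> x; rewrite (le_trans _ (hc x))// ler_norm.
Qed.

End BintTheory.

(* [A i] is the level set [{h >= i.+1 / n}]. *)
Lemma bmf_staircase d (T : measurableType d) (h : T -> R) (n : nat) :
  measurable_fun setT h -> (forall x, 0 <= h x <= 1) -> (0 < n)%N ->
  exists A : nat -> set T, (forall i, measurable (A i)) /\
    forall x, 0 <= h x - n%:R^-1 * \sum_(i < n) \1_(A i) x <= n%:R^-1.
Proof.
move=> mh h01 n0; exists (fun i => [set x | i.+1%:R / n%:R <= h x]); split.
  move=> i; rewrite -[X in measurable X]setTI.
  have -> : [set x | i.+1%:R / n%:R <= h x] = h @^-1` `[i.+1%:R / n%:R, +oo[.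
    by apply/seteqP; split => x /=; rewrite in_itv/= andbT.
  exact: mh.
move=> x; set k := Num.trunc (n%:R * h x).
have nR : 0 < n%:R :> R by rewrite ltr0n.
have /andP[hx0 hx1] := h01 x.
have nh0 : 0 <= n%:R * h x by rewrite mulr_ge0// ltW.
have /andP[kl kr] := truncn_itv nh0; rewrite -/k in kl kr.
have kn : (k <= n)%N.
  by rewrite -(ler_nat R) (le_trans kl)// ler_piMr// ltW.
have -> : \sum_(i < n) \1_[set y | i.+1%:R / n%:R <= h y] x = k%:R :> R.
  transitivity (\sum_(i < n | (i < k)%N) (1 : R)).
    rewrite [RHS]big_mkcond; apply: eq_bigr => i _; rewrite indicE.
    have -> : (x \in [set y | i.+1%:R / n%:R <= h y]) = (i < k)%N.
      rewrite truncn_gt_nat [n%:R * _]mulrC -ler_pdivrMr//.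
      by apply/idP/idP; rewrite inE.
    by case: ifP.
  by rewrite -(big_ord_widen _ (fun=> 1)) ?kn// sumr_const card_ord.
have e : n%:R^-1 * (n%:R * h x - k%:R) = h x - n%:R^-1 * k%:R.
  by rewrite mulrBr mulKf// gt_eqF.
rewrite -e pmulr_rge0 ?invr_gt0// subr_ge0 kl/= ger_pMr ?invr_gt0//.
by rewrite lerBlDr addrC natr1 ltW.
Qed.

(** A function with values in [[0, 1]] is, up to [1 / n], the average of the indicators of [n] level
    sets, so a gap of [r] on each indicator passes to the function without growing with [n]. The
    factor [2 c] is the length of [[- c, c]], and equal total masses cancel the shift used in the
    rescaling. This turns mixing bounds on sets into bounds on expectations. *)
Lemma bint_indic_close d (T : measurableType d) (lam1 lam2 : (T -> R) -> R)
    (r c : R) :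
  bint lam1 -> bint lam2 -> lam1 (fun=> 1) = lam2 (fun=> 1) ->
  (forall A, measurable A -> `|lam1 \1_A - lam2 \1_A| <= r) ->
  forall h, bmf h -> (forall x, `|h x| <= c) ->
  `|lam1 h - lam2 h| <= 2 * c * r.
Proof.
move=> b1 b2 e1 e12.
have unit h : bmf h -> (forall x, 0 <= h x <= 1) -> `|lam1 h - lam2 h| <= r.
  move=> bh h01; apply/ler_addgt0Pl => e e0.
  set m := lam1 (fun=> 1).
  (* The mesh is so fine that the staircase error [1 / n], integrated against the total mass [m], is
     at most [e]. *)
  pose n := (Num.trunc (m / e)).+1.
  have nm : m / n%:R <= e.
    rewrite ler_pdivrMr ?ltr0n// mulrC -ler_pdivrMr// ltW//.
    exact: truncnS_gt.
  have [A [mA hA]] := @bmf_staircase _ T h n bh.1 h01 isT.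
  pose u x := n%:R^-1 * \sum_(i < n) (\1_(A i) x : R).
  have bS : bmf (fun x => \sum_(i < n) (\1_(A i) x : R)).
    by apply: bmf_sum => i; apply: bmf_indic.
  have bu : bmf u by exact: bmfZ.
  have eu : `|lam1 u - lam2 u| <= r.
    rewrite !bintZ ?bint_sum//; try by move=> i; exact: bmf_indic.
    rewrite -mulrBr -sumrB normrM ger0_norm ?invr_ge0//.
    rewrite mulrC ler_pdivrMr ?ltr0n//.
    rewrite (le_trans (ler_norm_sum _ _ _))//.
    apply: (@le_trans _ _ (\sum_(i < n) r)); last first.
      by rewrite sumr_const card_ord mulr_natr.
    by apply: ler_sum => i _; exact: (e12 _ (mA i)).
  have bhu : bmf (fun x => h x - u x) by exact: bmfB.
  have -> : lam1 h - lam2 h = (lam1 u - lam2 u) +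
      (lam1 (fun x => h x - u x) - lam2 (fun x => h x - u x)).
    by rewrite !bintB//; ring.
  have B lam : bint lam -> lam (fun=> 1) = m ->
      0 <= lam (fun x => h x - u x) <= e.
    move=> bl lm; apply/andP; split.
      by apply: bint_ge0 => // x; case/andP: (hA x).
    apply: le_trans nm; rewrite mulrC -lm -bint_cst//.
    by apply: bint_le => //; [exact: bmf_cst|move=> x; case/andP: (hA x)].
  have /andP[l1 u1] := B _ b1 erefl.
  have /andP[l2 u2] := B _ b2 (esym e1).
  rewrite addrC (le_trans (ler_normD _ _))// lerD//.
  by rewrite ler_norml; apply/andP; split; lra.
move=> h bh hc; have c_ge0 : 0 <= c by rewrite (le_trans _ (hc point)).
have [c0|c0] := eqVneq c 0.
  have -> : h = (fun=> 0).
    by apply/funext => x; apply/eqP; rewrite -normr_le0 -c0.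
  by rewrite (bint_cst b1) (bint_cst b2) !mul0r subrr c0 mulr0 mul0r normr0.
have c_gt0 : 0 < c by rewrite lt_def c0.
pose g x := (2 * c)^-1 * (h x + c).
have bc : bmf (fun _ : T => c) by exact: bmf_cst.
have bg : bmf g by apply: bmfZ; exact: bmfD.
have cc : 2 * c != 0 by rewrite mulf_neq0 ?gt_eqF.
have hE : h = (fun x => 2 * c * g x - c).
  by apply/funext => x; rewrite /g mulVKf// addrK.
have E lam : bint lam -> lam h = 2 * c * lam g - c * lam (fun=> 1).
  move=> bl; rewrite {1}hE bintB//; last exact: bmfZ.
  by rewrite (bint_cst bl c) bintZ.
rewrite (E _ b1) (E _ b2) e1 opprB addrA subrK -mulrBr normrM.
rewrite ger0_norm ?mulr_ge0// ler_pM2l ?mulr_gt0//.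
apply: unit => // x; have := hc x; rewrite ler_norml => /andP[hx1 hx2].
have c2 : 0 < 2 * c by rewrite mulr_gt0.
rewrite /g mulrC ler_pdivlMr// ler_pdivrMr//.
by apply/andP; split; lra.
Qed.

Lemma bint_indic_ext d (T : measurableType d) (lam1 lam2 : (T -> R) -> R) :
  bint lam1 -> bint lam2 ->
  (forall A, measurable A -> lam1 \1_A = lam2 \1_A) ->
  forall h, bmf h -> lam1 h = lam2 h.
Proof.
move=> b1 b2 e12 h bh; have [c hc] := bh.2.
apply/eqP; rewrite -subr_eq0 -normr_le0 -(mulr0 (2 * c)).
apply: bint_indic_close => //; first by have := e12 setT measurableT; rewrite indicT.
by move=> A mA; rewrite e12// subrr normr0.
Qed.

Lemma bint_pi_system_ext d (T : measurableType d) (G : set (set T))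
    (lam1 lam2 : (T -> R) -> R) :
  bint lam1 -> bint lam2 -> @measurable _ T = <<s G >> -> setI_closed G ->
  G setT -> (forall A, G A -> lam1 \1_A = lam2 \1_A) ->
  forall h, bmf h -> lam1 h = lam2 h.
Proof.
move=> b1 b2 GE GI GT e12.
apply: bint_indic_ext => // A; rewrite GE.
have e1 : lam1 (fun=> 1) = lam2 (fun=> 1).
  by have := e12 setT GT; rewrite indicT.
move: A; apply: (dynkin_induction GE GI).
- exact: e12.
- exact: e12.
- move=> A mA eA.
  have cE : \1_(~` A) = (fun x => 1 - \1_A x) :> (T -> R).
    apply/funext => x; rewrite !indicE in_setC.
    by case: (x \in A); rewrite /= ?subrr ?subr0.
  by rewrite cE !bintB ?eA ?e1//; do ?[exact: bmf_cst|exact: bmf_indic].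
- move=> F mF tF eF.
  (* By disjointness these partial sums take only the values 0 and 1, which is the uniform bound
     that [bint_cvg] asks for. *)
  pose u n x : R := \sum_(i < n) \1_(F i) x.
  have bF i : bmf (\1_(F i) : T -> R) by exact: bmf_indic.
  have bu n : bmf (u n) by apply: bmf_sum.
  have uE k x n : F k x -> u n x = (k < n)%N%:R.
    move=> Fkx; have Fi i : i != k -> \1_(F i) x = 0 :> R.
      move=> ik; rewrite indicE memNset// => Fix.
      by move/eqP : ik; apply; apply: (tF i k) => //; exists x.
    case: ltnP => kn; last first.
      by apply: big1 => i _; apply: Fi; rewrite ltn_eqF// (leq_trans (ltn_ord i)).
    rewrite /u (bigD1 (Ordinal kn))//= big1 ?addr0.
      by rewrite indicE mem_set.
    by move=> i ik; apply: Fi.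
  have u0 x n : ~ (\bigcup_k F k) x -> u n x = 0.
    move=> Fx; apply: big1 => i _; rewrite indicE memNset// => Fix; apply: Fx.
    by exists i.
  have bU : bmf (\1_(\bigcup_k F k) : T -> R).
    by apply: bmf_indic; exact: bigcupT_measurable.
  have u1 n x : `|u n x| <= 1.
    have [[k _ Fk]|Fx] := pselect ((\bigcup_k F k) x).
      by rewrite (uE k)//; case: (k < n)%N; rewrite ?normr1 ?normr0.
    by rewrite u0// normr0.
  have ucvg x : u ^~ x @ \oo --> (\1_(\bigcup_k F k) x : R).
    have [[k _ Fk]|Fx] := pselect ((\bigcup_k F k) x).
      rewrite indicE mem_set; last by exists k.
      apply: cvg_near_cst; near=> n; rewrite (uE k)//.
      by have -> : (k < n)%N by near: n; exact: nbhs_infty_gt.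
    rewrite indicE memNset//; apply: cvg_near_cst; near=> n.
    by rewrite u0.
  have c1 := bint_cvg b1 bu bU u1 ucvg.
  have c2 := bint_cvg b2 bu bU u1 ucvg.
  have e n : lam1 (u n) = lam2 (u n).
    by rewrite !bint_sum//; apply: eq_bigr => i _.
  apply: (@cvg_unique _ (@Rhausdorff R) _ _ _ _ c1).
  by rewrite /= (funext e).
Unshelve. all: by end_near. Qed.

Lemma bint_Rintegral d (T : measurableType d) (mu : {measure set T -> \bar R})
    (D : set T) :
  measurable D -> (mu setT < +oo)%E -> bint (fun h => \int[mu]_(x in D) h x).
Proof.
move=> mD mufin; have I h : bmf h -> mu.-integrable D (EFin \o h).
  exact: bmf_integrable.
split.
- by move=> f g bf bg; rewrite RintegralD//; exact: I.
- by move=> a f bf; rewrite RintegralZl//; exact: I.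
- by move=> f bf f0; apply: Rintegral_ge0.
- move=> u f c bu bf uc uf.
  have [] := @dominated_convergence _ _ _ mu _ mD (fun n => EFin \o u n)
    (EFin \o f) (fun=> c%:E).
  + by move=> n; apply/measurable_EFinP/measurable_funTS; exact: (bu n).1.
  + by apply/measurable_EFinP/measurable_funTS; exact: bf.1.
  + apply: aeW => x _; apply: cvg_EFin; first exact: nearW.
    exact: uf.
  + exact: (@I (fun=> c) (bmf_cst _ c)).
  + by apply: aeW => x n _ /=; rewrite lee_fin.
  + move=> _ _ cv; apply: fine_cvg.
    move: cv; rewrite /= /Rintegral fineK//.
    by apply: integrable_fin_num => //; exact: I.
Qed.

Lemma bint_pull d d' (T : measurableType d) (T' : measurableType d')
    (lam : (T -> R) -> R) (phi : T -> T') :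
  bint lam -> measurable_fun setT phi -> bint (fun h => lam (h \o phi)).
Proof.
move=> bl mphi; have B h : bmf h -> bmf (h \o phi) by exact: bmf_comp.
split.
- by move=> f g bf bg; rewrite -bintD//; exact: B.
- by move=> a f bf; rewrite -bintZ//; exact: B.
- by move=> f bf f0; apply: bint_ge0 => //; [exact: B|move=> x; exact: f0].
- move=> u f c bu bf uc uf.
  apply: (@bint_cvg _ _ _ bl _ _ c) => [n||n x|x]; [exact: B|exact: B| |].
  + exact: uc.
  + exact: uf.
Qed.

(** Integration against a kernel followed by [lam]. The mass bound on [kap x] keeps the inner
    integrals of a bounded sequence within its bound, so convergence passes through [kap x] and then
    through [lam]. *)
Lemma bint_comp d d' (T : measurableType d) (T' : measurableType d')
    (lam : (T -> R) -> R) (kap : T -> (T' -> R) -> R) :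
  bint lam -> (forall x, bint (kap x)) -> (forall x, kap x (fun=> 1) <= 1) ->
  (forall h, bmf h -> bmf (kap^~ h)) -> bint (fun h => lam (kap^~ h)).
Proof.
move=> bl bk k1 bb; split.
- move=> f g bf bg; rewrite -bintD//; [|exact: bb..].
  by congr lam; apply/funext => x; rewrite bintD.
- move=> a f bf; rewrite -bintZ//; [|exact: bb].
  by congr lam; apply/funext => x; rewrite bintZ.
- move=> f bf f0; apply: bint_ge0 => //; [exact: bb|].
  by move=> x; exact: bint_ge0.
- move=> u f c bu bf uc uf.
  apply: (bint_cvg bl (c := `|c|)) => [n||n x|x]; [exact: bb|exact: bb| |].
  + have c0 : 0 <= c by rewrite (le_trans _ (uc 0 point))//.
    have := bint_abs_le (bk x) (bu n) (uc n).
    by rewrite (ger0_norm c0) => /le_trans; apply; exact: ler_piMr.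
  + exact: (bint_cvg (bk x) (c := c)).
Qed.

End BoundedMeasurable.

(** * The transition operator, its invariant law and mixing *)

Section KernelOperator.
Context {R : realType} (dS : measure_display) (S : measurableType dS).
Variable Q : R.-pker S ~> S.

Definition KQ (h : S -> R) (z : S) : R := \int[Q z]_y h y.

Lemma KQ_fin z : (Q z setT < +oo)%E.
Proof. by rewrite prob_kernel ltry. Qed.

Lemma bint_KQ z : bint (KQ^~ z).
Proof. by apply: bint_Rintegral; [exact: measurableT|exact: KQ_fin]. Qed.

Lemma KQ1 z : KQ (fun=> 1) z = 1.
Proof. by rewrite /KQ Rintegral_cst// prob_kernel mul1r. Qed.

Lemma KQ_cst c z : KQ (fun=> c) z = c.
Proof. by rewrite (bint_cst (bint_KQ z)) KQ1 mulr1. Qed.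

Lemma KQ_EFin h z : bmf h -> (KQ h z)%:E = (\int[Q z]_y (h y)%:E)%E.
Proof.
move=> bh; rewrite /KQ /Rintegral fineK//.
by apply: integrable_fin_num => //; apply: bmf_integrable => //; exact: KQ_fin.
Qed.

Lemma KQ_le h c z : bmf h -> (forall y, `|h y| <= c) -> `|KQ h z| <= c.
Proof.
by move=> bh hc; have := bint_abs_le (bint_KQ z) bh hc; rewrite KQ1 mulr1.
Qed.

(** In the Markov property, the parameter is the past outcome and the second component the current
    state. *)
Lemma bmf_KQ_param dW (W : measurableType dW) (phi : W * S -> R) :
  bmf phi -> bmf (fun p : W * S => KQ (fun y => phi (p.1, y)) p.2).
Proof.
move=> bphi; have [mphi [c hc]] := bphi.
have bsec w : bmf (fun y => phi (w, y)).
  by apply: (bmf_comp _ bphi); exact: pair1_measurable.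
split; last by exists c => p; apply: KQ_le.
(* Adding the bound [c] makes the integrand nonnegative, as the measurability theorem for kernel
   integrals wants; since [Q] has mass one, the shift is removed by subtracting [c]. *)
pose k (q : (W * S) * S) : \bar R := (phi (q.1.1, q.2) + c)%:E.
have k0 q : (0 <= k q)%E.
  by rewrite lee_fin -lerBlDr sub0r; have := hc (q.1.1, q.2); rewrite ler_norml => /andP[].
have mk : measurable_fun setT k.
  apply/measurable_EFinP; apply: measurable_funD => //.
  apply: (measurableT_comp mphi); apply/measurable_fun_pairP; split => /=.
    exact: (measurableT_comp measurable_fst measurable_fst).
  exact: measurable_snd.
have mI := @measurable_fun_integral_finite_kernel _ _ (W * S)%type S R k
  (@kernel.kernel_snd dW dS dS W S S R Q) k0 mk.
rewrite [X in measurable_fun _ X](_ : _ = (fun p =>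
    fine (\int[kernel.kernel_snd Q p]_y k (p, y))%E - c)); last first.
  apply/funext => p; rewrite -[X in _ = X - _]/(KQ (fun y => phi (p.1, y) + c) p.2).
  by rewrite (bintD (bint_KQ p.2))// ?KQ_cst ?addrK//; exact: bmf_cst.
apply: measurable_funD => //; apply: measurableT_comp => //.
Qed.

Lemma bmf_KQ h : bmf h -> bmf (KQ h).
Proof.
move=> bh; have bh2 : bmf (fun p : S * S => h p.2).
  by apply: (bmf_comp _ bh); exact: measurable_snd.
apply: (bmf_comp (phi := fun z : S => (z, z)) _ (bmf_KQ_param bh2)).
by apply/measurable_fun_pairP; split; exact: measurable_id.
Qed.

Lemma bmf_iter_KQ n h : bmf h -> bmf (iter n KQ h).
Proof. by move=> bh; elim: n => //= n; exact: bmf_KQ. Qed.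

Lemma bint_iter_KQ n z : bint (fun h => iter n KQ h z).
Proof.
elim: n z => [|n IH] z /=.
  by split.
apply: (@bint_comp _ _ _ _ _ (KQ^~ z) (fun x h => iter n KQ h x)) => //.
- exact: bint_KQ.
- move=> x; elim: n {IH} x => //= n IH x.
  rewrite -[leRHS](KQ_cst 1 x); apply: (bint_le (bint_KQ x)) => //.
    exact/bmf_iter_KQ/bmf_cst.
  exact: bmf_cst.
- by move=> h; exact: bmf_iter_KQ.
Qed.

Lemma iter_KQ1 n z : iter n KQ (fun=> 1) z = 1.
Proof.
elim: n z => //= n IH z.
by rewrite (_ : iter n KQ _ = fun=> 1) ?KQ1//; exact/funext.
Qed.

Lemma QpowE n z A : measurable A -> Qpow Q n z A = (iter n KQ \1_A z)%:E.
Proof.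
move=> mA; elim: n z => //= n IH z.
by rewrite KQ_EFin; [apply: eq_integral => y _; rewrite IH|
  exact/bmf_iter_KQ/bmf_indic].
Qed.

Lemma KQ_indic A z : measurable A -> (KQ \1_A z)%:E = Q z A.
Proof.
by move=> mA; rewrite KQ_EFin ?integral_indic ?setIT//; exact: bmf_indic.
Qed.

Variables (mu : probability S R) (tau : nat).
Hypothesis Qmu : Q_invariant Q mu.
Hypothesis mix : forall k z z' A, measurable A ->
  (`| Qpow Q k z A - Qpow Q k z' A | <= ((4^-1) ^+ (k %/ tau))%:E)%E.

Lemma prob_fin dT (T : measurableType dT) (P : probability T R) :
  (P setT < +oo)%E.
Proof. by rewrite probability_setT ltry. Qed.

Lemma bint_prob dT (T : measurableType dT) (P : probability T R) :
  bint (fun h => \int[P]_x h x).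
Proof. by apply: bint_Rintegral; [exact: measurableT|exact: prob_fin]. Qed.

Lemma Rintegral1 dT (T : measurableType dT) (P : probability T R) :
  \int[P]_x 1 = 1 :> R.
Proof.
transitivity (1 * fine (P setT)); first exact: Rintegral_cst.
by rewrite probability_setT mul1r.
Qed.

Lemma Rintegral_KQ h : bmf h -> \int[mu]_z KQ h z = \int[mu]_z h z.
Proof.
move: h; apply: bint_indic_ext; last first.
- move=> A mA; rewrite /Rintegral; congr fine.
  rewrite integral_indic// setIT; under eq_integral do rewrite KQ_indic//.
  exact/esym/Qmu.
- exact: bint_prob.
- apply: (@bint_comp _ _ _ _ _ (fun h => \int[mu]_z h z) (fun z h => KQ h z)).
  + exact: bint_prob.
  + exact: bint_KQ.
  + by move=> x; rewrite KQ1.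
  + exact: bmf_KQ.
Qed.

Lemma Rintegral_iter_KQ n h : bmf h ->
  \int[mu]_z iter n KQ h z = \int[mu]_z h z.
Proof.
by move=> bh; elim: n => //= n IH; rewrite Rintegral_KQ//; exact: bmf_iter_KQ.
Qed.

(** By invariance, the [mu]-mean of [h] is that of its [n]-step average, so the difference is a
    [mu]-average over [x] of the gaps between chains started at [z] and at [x]; each gap is
    controlled by mixing. *)
Lemma iter_KQ_mixing n h (c : R) z : bmf h -> (forall y, `|h y| <= c) ->
  `|iter n KQ h z - \int[mu]_y h y| <= 2 * c * (4^-1) ^+ (n %/ tau).
Proof.
move=> bh hc; rewrite -(Rintegral_iter_KQ n)//.
have bn := bmf_iter_KQ n bh.
have bm := bint_prob mu.
pose g x := iter n KQ h z - iter n KQ h x.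
have bg : bmf g by apply: bmfB => //; exact: bmf_cst.
have -> : iter n KQ h z - \int[mu]_x iter n KQ h x = \int[mu]_x g x.
  rewrite (bintB bm)//; last exact: bmf_cst.
  by rewrite (bint_cst bm) Rintegral1 mulr1.
pose e : R := 2 * c * 4^-1 ^+ (n %/ tau); rewrite -/e.
suff ge x : `|g x| <= e.
  by have := bint_abs_le bm bg ge; rewrite Rintegral1 mulr1.
apply: (@bint_indic_close R _ S (fun h => iter n KQ h z) (fun h => iter n KQ h x)) => //.
- exact: bint_iter_KQ.
- exact: bint_iter_KQ.
- by rewrite !iter_KQ1.
- by move=> A mA; rewrite -lee_fin; have := mix n z x mA; rewrite !QpowE.
Qed.

End KernelOperator.

(** * The filtration generated by the chain *)

Section Filtration.
Context {R : realType} (dS dO : measure_display) (S : measurableType dS)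
  (Omega : measurableType dO).
Variable Z : nat -> Omega -> S.

Definition cyl_set (B : nat -> set S) (t : nat) : set Omega :=
  [set w | forall i, (i <= t)%N -> B i (Z i w)].

(* [cyl t] generates the sigma-algebra of the past of [Z] up to time [t]. *)
Definition cyl (t : nat) : set (set Omega) :=
  [set A | exists B : nat -> set S,
    (forall i, measurable (B i)) /\ A = cyl_set B t].

Local Notation Ft t := (g_sigma_algebraType (cyl t)).

Lemma cyl_setIP t : setI_closed (cyl t).
Proof.
move=> _ _ [B [mB ->]] [C [mC ->]]; exists (fun i => B i `&` C i); split.
  by move=> i; exact: measurableI.
apply/seteqP; split => [w [Bw Cw] i it|w BCw].
  by split; [exact: Bw|exact: Cw].
by split => i it; have [] := BCw i it.
Qed.

Lemma cyl_setT t : cyl t setT.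
Proof. by exists (fun=> setT); split => //; apply/seteqP; split. Qed.

Lemma cyl_homo t t' : (t <= t')%N -> cyl t `<=` cyl t'.
Proof.
move=> tt' _ [B [mB ->]]; exists (fun i => if (i <= t)%N then B i else setT).
split; first by move=> i; case: ifP.
apply/seteqP; split => w Bw i it; first by case: ifP => // it'; exact: Bw.
by have := Bw i (leq_trans it tt'); rewrite it.
Qed.

Lemma measurable_id_Ft t t' : (t <= t')%N ->
  measurable_fun setT (id : Ft t' -> Ft t).
Proof.
move=> tt' _ A mA; rewrite setTI preimage_id.
by apply: sub_sigma_algebra2 mA; exact: cyl_homo.
Qed.

Lemma measurable_Z_Ft t i : (i <= t)%N -> measurable_fun setT (Z i : Ft t -> S).
Proof.
move=> it _ A mA; rewrite setTI; apply: sub_sigma_algebra.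
exists (fun k => if k == i then A else setT); split.
  by move=> k; case: ifP.
apply/seteqP; split => w; first by move=> Aw k _; case: eqP => // ->.
by move=> /(_ i it); rewrite eqxx.
Qed.

Hypothesis mZ : forall i, measurable_fun setT (Z i).

Lemma measurable_cyl t A : cyl t A -> measurable A.
Proof.
move=> [B [mB ->]].
have -> : cyl_set B t = \bigcap_(i in [set i | (i <= t)%N]) (Z i @^-1` B i).
  by apply/seteqP; split => w Bw i /=; exact: Bw.
apply: bigcap_measurable; first by exists 0%N.
by move=> i _; rewrite -[X in measurable X]setTI; exact: mZ.
Qed.

Lemma measurable_id_Omega t : measurable_fun setT (id : Omega -> Ft t).
Proof.
move=> _ A mA; rewrite setTI preimage_id.
by apply: smallest_sub mA; [exact: sigma_algebra_measurable|exact: measurable_cyl].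
Qed.

Lemma bmf_Ft t t' (Y : Omega -> R) : (t <= t')%N ->
  bmf (Y : Ft t -> R) -> bmf (Y : Ft t' -> R).
Proof. by move=> tt'; apply: bmf_comp; exact: measurable_id_Ft. Qed.

Lemma bmf_Omega t (Y : Omega -> R) : bmf (Y : Ft t -> R) -> bmf Y.
Proof. by apply: bmf_comp; exact: measurable_id_Omega. Qed.

(** Both projections are measurable for the sigma-algebra generated by these rectangles. With
    cylinders as first sides the rectangles form a pi-system whose probabilities are
    finite-dimensional laws of the chain. *)
Lemma Ft_prodE t : @measurable _ (Ft t * S)%type =
  <<s [set A `*` B | A in cyl t & B in measurable] >>.
Proof.
set G := [set A `*` B | A in cyl t & B in measurable].
rewrite measurable_prod_measurableType; apply/seteqP; split; last first.
  apply: smallest_sub; first exact: smallest_sigma_algebra.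
  move=> _ [A cA [B mB <-]]; apply: sub_sigma_algebra.
  by exists A; [exact: sub_sigma_algebra|exists B].
pose U := g_sigma_algebraType (G : set (set (Omega * S))).
have mfst : measurable_fun setT (fst : U -> Ft t).
  apply: (@measurability _ _ U (Ft t) setT fst (cyl t)) => //.
  move=> _ [A cA <-]; apply: sub_sigma_algebra; exists A => //.
  by exists setT => //; rewrite setTI setXT.
have msnd : measurable_fun setT (snd : U -> S).
  move=> _ B mB; apply: sub_sigma_algebra; exists setT; first exact: cyl_setT.
  by exists B => //; rewrite setTI setTX.
apply: smallest_sub; first exact: smallest_sigma_algebra.
move=> _ [A mA [B mB <-]].
have -> : A `*` B = (fst @^-1` A) `&` (snd @^-1` B) :> set (Omega * S) by [].
apply: (@measurableI _ U); rewrite -[X in measurable X]setTI.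
  exact: mfst.
exact: msnd.
Qed.

(** * The Markov property and decorrelation *)

Section Chain.
Variables (Q : R.-pker S ~> S) (mu : probability S R) (P : probability Omega R).

(* [rec_op A n i h z] is the expectation of
   [1_(A i)(Y_i) ... 1_(A (i + n))(Y_(i + n)) h(Y_(i + n))] for a chain [Y] with
   kernel [Q] and [Y_i = z]. *)
Fixpoint rec_op (A : nat -> set S) (n i : nat) (h : S -> R) (z : S) : R :=
  \1_(A i) z * (if n is n'.+1 then KQ Q (rec_op A n' i.+1 h) z else h z).

Lemma bmf_rec_op A n i h : (forall k, measurable (A k)) -> bmf h ->
  bmf (rec_op A n i h).
Proof.
move=> mA bh; elim: n i => [|n IH] i; apply: bmfM => //; try exact: bmf_indic.
exact/bmf_KQ/IH.
Qed.

Lemma rec_op_le1 A n i z : (forall k, measurable (A k)) ->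
  rec_op A n i (fun=> 1) z <= 1.
Proof.
move=> mA; have i1 k y : 0 <= (\1_(A k) y : R) <= 1.
  by rewrite indicE; case: (_ \in _); rewrite /= ?lexx ?ler01.
elim: n i z => [|n IH] i z /=; have /andP[i0 il] := i1 i z; first by rewrite mulr1.
rewrite -[leRHS]mul1r; apply: (@le_trans _ _ (\1_(A i) z * 1)).
  apply: ler_wpM2l => //; rewrite -[leRHS](KQ_cst Q 1 z).
  apply: (bint_le (bint_KQ Q z)); [|exact: bmf_cst|exact: IH].
  by apply: bmf_rec_op => //; exact: bmf_cst.
exact: ler_wpM2r.
Qed.

Lemma bint_scale d (T : measurableType d) (lam : (T -> R) -> R) a : 0 <= a ->
  bint lam -> bint (fun h => a * lam h).
Proof.
move=> a0 bl; split.
- by move=> f g bf bg; rewrite bintD// mulrDr.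
- by move=> b f bf; rewrite bintZ// mulrCA.
- by move=> f bf f0; rewrite mulr_ge0//; exact: bint_ge0.
- move=> u f c bu bf uc uf; apply: cvgMr; exact: (bint_cvg bl bu bf uc uf).
Qed.

Lemma bint_rec_op A n i z : (forall k, measurable (A k)) ->
  bint (fun h => rec_op A n i h z).
Proof.
move=> mA; elim: n i z => [|n IH] i z.
  apply: (@bint_scale _ S (fun h => h z)); last by split.
  by rewrite indicE; case: (_ \in _).
apply: (@bint_scale _ S (fun h => KQ Q (rec_op A n i.+1 h) z)).
  by rewrite indicE; case: (_ \in _).
apply: (@bint_comp _ _ _ _ _ (KQ Q ^~ z) (fun x h => rec_op A n i.+1 h x)).
- exact: bint_KQ.
- by move=> x; exact: IH.
- by move=> x; exact: rec_op_le1.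
- by move=> h; exact: bmf_rec_op.
Qed.

(** [rec_op] unfolds at the first transition; here the last one is peeled off, which is where the
    Markov property at the final time is read. *)
Lemma rec_opS A n i h z :
  rec_op A n.+1 i h z =
  rec_op A n i (KQ Q (fun y => \1_(A (i + n).+1) y * h y)) z.
Proof.
elim: n i z => [|n IH] i z; first by rewrite addn0.
transitivity (\1_(A i) z * KQ Q (rec_op A n.+1 i.+1 h) z) => //.
by rewrite (funext (IH i.+1)) addSnnS.
Qed.

(** A final test function that is an indicator can be absorbed into the last set, which gives back a
    finite-dimensional law. *)
Lemma rec_op_last A n i B z :
  rec_op (fun k => if k == (i + n)%N then A k `&` B else A k) n i (fun=> 1) z =
  rec_op A n i \1_B z.
Proof.
elim: n i z => [|n IH] i z /=; first by rewrite addn0 eqxx mulr1 indicI.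
rewrite ifN; last by rewrite -[X in X != _]addn0 eqn_add2l.
congr (_ * KQ _ _ _); apply/funext => y; rewrite -IH.
by rewrite addSnnS.
Qed.

Lemma ktail_rec_op A n i z : (forall k, measurable (A k)) ->
  ((\1_(A i) z : R)%:E * ktail Q A n i z)%E = (rec_op A n i (fun=> 1) z)%:E.
Proof.
move=> mA; elim: n i z => [|n IH] i z /=; first by rewrite mule1 mulr1.
under eq_integral do rewrite IH.
by rewrite -KQ_EFin ?EFinM//; apply: bmf_rec_op => //; exact: bmf_cst.
Qed.

Lemma markov_fddE A n : (forall k, measurable (A k)) ->
  markov_fdd mu Q A n = (\int[mu]_z rec_op A n 0 (fun=> 1) z)%:E.
Proof.
move=> mA; rewrite /markov_fdd; under eq_integral do rewrite ktail_rec_op//.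
rewrite /Rintegral fineK//; apply: integrable_fin_num => //.
apply: bmf_integrable => //; first exact: prob_fin.
by apply: bmf_rec_op => //; exact: bmf_cst.
Qed.

Hypothesis fdd : forall n A, (forall i, measurable (A i)) ->
  P (cyl_set A n) = markov_fdd mu Q A n.

Lemma measurable_cyl_set B t : (forall i, measurable (B i)) ->
  measurable (cyl_set B t).
Proof. by move=> mB; apply: (@measurable_cyl t); exists B. Qed.

Lemma Rintegral_indic D A : measurable D -> measurable A ->
  \int[P]_(w in D) \1_A w = fine (P (A `&` D)).
Proof. by move=> mD mA; rewrite /Rintegral integral_indic. Qed.

(** Both sides are functionals of [h], so indicators suffice; there the test set joins the last
    factor of the cylinder and [fdd] applies. *)
Lemma cyl_set_fdd A n h : (forall i, measurable (A i)) -> bmf h ->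
  \int[P]_(w in cyl_set A n) h (Z n w) = \int[mu]_z rec_op A n 0 h z.
Proof.
move=> mA; move: h; apply: bint_indic_ext.
- apply: (@bint_pull _ _ _ _ _ (fun h => \int[P]_(w in cyl_set A n) h w)) => //.
  apply: bint_Rintegral; [exact: measurable_cyl_set|exact: prob_fin].
- apply: (@bint_comp _ _ _ _ _ (fun h => \int[mu]_z h z)
    (fun z h => rec_op A n 0 h z)).
  + exact: bint_prob.
  + by move=> x; exact: bint_rec_op.
  + by move=> x; exact: rec_op_le1.
  + by move=> h; exact: bmf_rec_op.
- move=> B mB; pose A' k := if k == (0 + n)%N then A k `&` B else A k.
  have mA' k : measurable (A' k) by rewrite /A'; case: ifP => // _; exact: measurableI.
  transitivity (\int[mu]_z rec_op A' n 0 (fun=> 1) z); last first.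
    by congr Rintegral; apply/funext => z; rewrite rec_op_last.
  apply: EFin_inj; rewrite -markov_fddE// -fdd//.
  have mZB : measurable (Z n @^-1` B) by rewrite -[X in measurable X]setTI; exact: mZ.
  transitivity (fine (P (Z n @^-1` B `&` cyl_set A n)))%:E.
    by rewrite -Rintegral_indic//; exact: measurable_cyl_set.
  rewrite fineK; last first.
    by apply: fin_num_measure; apply: measurableI => //; exact: measurable_cyl_set.
  congr (P _); apply/seteqP; split => w.
    by move=> [Bw Aw] i it; rewrite /A' add0n; case: eqP => [->|_]; [split => //|]; exact: Aw.
  move=> A'w; split; first by have := A'w n (leqnn n); rewrite /A' add0n eqxx => -[].
  by move=> i it; have := A'w i it; rewrite /A'; case: ifP => // _ [].
Qed.

(** Appending [B] to the cylinder at time [t + 1] makes the left side a finite-dimensional law;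
    peeling off its last transition gives the right side. *)
Lemma markov_rect t A B : cyl t A -> measurable B ->
  \int[P]_w (\1_A w * \1_B (Z t.+1 w)) =
  \int[P]_w (\1_A w * KQ Q \1_B (Z t w)).
Proof.
move=> [C [mC ->]] mB.
pose C' k := if k == t.+1 then B else C k.
have mC' k : measurable (C' k) by rewrite /C'; case: ifP.
have CE : cyl_set C t = cyl_set C' t.
  apply/seteqP; split => w Cw i it; have := Cw i it; rewrite /C'.
    by rewrite ltn_eqF.
  by rewrite ltn_eqF.
have indicE' D (h : Omega -> R) : measurable D ->
    \int[P]_w (\1_D w * h w) = \int[P]_(w in D) h w.
  move=> mD; rewrite [RHS]Rintegral_mkcond; congr Rintegral; apply/funext => w.
  by rewrite patchE indicE; case: (_ \in _); rewrite ?mul1r ?mul0r.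
rewrite CE [RHS]indicE'; last exact: measurable_cyl_set.
rewrite cyl_set_fdd//; last exact/bmf_KQ/bmf_indic.
transitivity (\int[mu]_z rec_op C' t.+1 0 (fun=> 1) z); last first.
  congr Rintegral; apply/funext => z; rewrite rec_opS add0n.
  congr rec_op; congr KQ; apply/funext => y.
  by rewrite mulr1 /C' eqxx.
apply: EFin_inj; rewrite -markov_fddE// -fdd//.
have mZB : measurable (Z t.+1 @^-1` B).
  by rewrite -[X in measurable X]setTI; exact: mZ.
transitivity (fine (P (Z t.+1 @^-1` B `&` cyl_set C' t)))%:E.
  rewrite -Rintegral_indic//; last exact: measurable_cyl_set.
  by rewrite indicE'//; exact: measurable_cyl_set.
rewrite fineK; last first.
  by apply: fin_num_measure; apply: measurableI => //; exact: measurable_cyl_set.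
congr (P _); apply/seteqP; split => w.
  move=> [Bw Cw] i; rewrite leq_eqVlt => /predU1P[->|]; first by rewrite /C' eqxx.
  by rewrite ltnS; exact: Cw.
move=> Cw; split; first by have := Cw t.+1 (leqnn _); rewrite /C' eqxx.
by move=> i it; apply: Cw; rewrite (leq_trans it).
Qed.

Lemma measurable_pair_Z t k :
  measurable_fun setT (fun w : Omega => (w, Z k w) : Ft t * S).
Proof.
apply/measurable_fun_pairP; split; first exact: measurable_id_Omega.
exact: mZ.
Qed.

Lemma bmf_pair_Z t k (phi : Ft t * S -> R) : bmf phi ->
  bmf (fun w : Omega => phi (w, Z k w)).
Proof.
move=> bphi.
apply: (@bmf_comp R _ (Ft t * S)%type _ Omega (fun w => (w, Z k w)) phi) => //.
exact: measurable_pair_Z.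
Qed.

(** The test function may depend on the whole past through [w], which is what lets an iterate of the
    algorithm enter. It holds on rectangles and extends because both sides are functionals of
    [phi]. *)
Lemma markov_step t (phi : Ft t * S -> R) : bmf phi ->
  \int[P]_w phi (w, Z t.+1 w) = \int[P]_w KQ Q (fun y => phi (w, y)) (Z t w).
Proof.
move: phi; apply: bint_pi_system_ext (Ft_prodE t) _ _ _.
- apply: (@bint_pull _ _ _ _ _ (fun h => \int[P]_w h w)); first exact: bint_prob.
  exact: measurable_pair_Z.
- apply: (@bint_comp R _ _ Omega (Ft t * S)%type (fun h => \int[P]_w h w)
    (fun w h => KQ Q (fun y => h (w, y)) (Z t w))).
  + exact: bint_prob.
  + move=> w; apply: (@bint_pull _ _ _ _ _ (KQ Q ^~ (Z t w)) (fun y => (w : Ft t, y))).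
      exact: bint_KQ.
    exact: pair1_measurable.
  + by move=> w; rewrite KQ1.
  + move=> h bh; exact: (bmf_pair_Z t (bmf_KQ_param Q bh)).
- move=> _ _ [A cA [B mB <-]] [A' cA' [B' mB' <-]].
  exists (A `&` A'); first exact: cyl_setIP.
  by exists (B `&` B'); [exact: measurableI|rewrite setXI].
- by exists setT; [exact: cyl_setT|exists setT => //; rewrite setXTT].
- move=> _ [A cA [B mB <-]].
  have e w y : \1_(A `*` B) (w, y) = \1_A w * \1_B y :> R.
    by rewrite !indicE in_setX; case: (_ \in _); rewrite ?mul1r ?mul0r.
  under eq_Rintegral do rewrite e; rewrite markov_rect//.
  congr Rintegral; apply/funext => w.
  rewrite -bintZ; [|exact: bint_KQ|exact: bmf_indic].
  by congr KQ; apply/funext => y; rewrite e.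
Qed.

(** Each induction step removes the last transition, with the past temporarily enlarged to time
    [t + k]; what remains is again a function of the past at [t] and one later state. *)
Lemma markov_iter t k (phi : Ft t * S -> R) : bmf phi ->
  \int[P]_w phi (w, Z (t + k)%N w) =
  \int[P]_w iter k (KQ Q) (fun y => phi (w, y)) (Z t w).
Proof.
elim: k phi => [|k IH] phi bphi; first by rewrite addn0.
have tk : (t <= t + k)%N by exact: leq_addr.
pose psi (p : Ft (t + k) * S) : R := phi (p.1, p.2).
have bpsi : bmf psi.
  apply: (bmf_comp (phi := fun p : Ft (t + k) * S => (p.1, p.2) : Ft t * S) _ bphi).
  apply/measurable_fun_pairP; split; last exact: measurable_snd.
  by apply: (measurableT_comp (measurable_id_Ft tk)); exact: measurable_fst.
rewrite addnS; have := markov_step bpsi; rewrite /psi /= => ->.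
rewrite (IH (fun p => KQ Q (fun y => phi (p.1, y)) p.2)); last exact: bmf_KQ_param.
by congr Rintegral; apply/funext => w; rewrite -[RHS]/(iter k.+1 _ _ _) iterSr.
Qed.

Variable tau : nat.
Hypothesis Qmu : Q_invariant Q mu.
Hypothesis mix : forall k z z' A, measurable A ->
  (`| Qpow Q k z A - Qpow Q k z' A | <= ((4^-1) ^+ (k %/ tau))%:E)%E.

(** With the outcome [w] frozen, the [k]-step average of [phi] is close to its [mu]-mean, which is
    zero. Freezing [w] allows the bound [s] to vary with it, as the noise level does with the
    iterate. *)
Lemma decorrelation t k (phi : Ft t * S -> R) (s : Omega -> R) :
  bmf phi -> bmf s -> (forall w y, `|phi (w, y)| <= s w) ->
  (forall w, \int[mu]_y phi (w, y) = 0) ->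
  `|\int[P]_w phi (w, Z (t + k)%N w)| <=
    2 * (4^-1) ^+ (k %/ tau) * \int[P]_w s w.
Proof.
move=> bphi bs phis phi0; rewrite markov_iter//.
have bP := bint_prob P.
have bsec w : bmf (fun y => phi (w, y)).
  by apply: (bmf_comp _ bphi); exact: pair1_measurable.
have bit : bmf (fun w : Omega => iter k (KQ Q) (fun y => phi (w, y)) (Z t w)).
  pose F k (p : Ft t * S) := iter k (KQ Q) (fun y => phi (p.1, y)) p.2.
  have bF : bmf (F k).
    elim: (k) => [|k' IH]; last exact: (bmf_KQ_param Q IH).
    by rewrite (_ : F 0%N = phi)//; apply/funext => -[].
  exact: (bmf_pair_Z t bF).
pose c : R := 2 * (4^-1) ^+ (k %/ tau).
have le w : `|iter k (KQ Q) (fun y => phi (w, y)) (Z t w)| <= c * s w.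
  have := iter_KQ_mixing Qmu mix k (Z t w) (bsec w) (phis w).
  by rewrite phi0 subr0 mulrAC.
rewrite -/c -(bintZ bP)// ler_norml -mulN1r -(bintZ bP); last exact: bmfZ.
have bcs : bmf (fun w => c * s w) by exact: bmfZ.
apply/andP; split; apply: (bint_le bP) => //; first exact: bmfZ.
- by move=> w; have := le w; rewrite ler_norml mulN1r => /andP[].
- by move=> w; rewrite (le_trans (ler_norm _)).
Qed.

End Chain.

Section Independence.
Variables (P : probability Omega R) (E : set Omega) (p : R) (t : nat).
Hypothesis mE : measurable E.
Hypothesis p0 : 0 <= p.
Hypothesis indE : forall A, cyl t A -> P (A `&` E) = (P A * p%:E)%E.

(** Independence from cylinders, a pi-system, extends to every function of the past. The event [E]
    will prescribe levels and [p] will be their probability. *)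
Lemma Rintegral_indep (Y : Omega -> R) : bmf (Y : Ft t -> R) ->
  \int[P]_(w in E) Y w = p * \int[P]_w Y w.
Proof.
move: Y; apply: (@bint_pi_system_ext R _ (Ft t) (cyl t)) => //.
- apply: (@bint_pull _ _ _ _ _ (fun h => \int[P]_(w in E) h w) (id : Omega -> Ft t)).
    by apply: bint_Rintegral => //; exact: prob_fin.
  exact: measurable_id_Omega.
- apply: bint_scale => //.
  apply: (@bint_pull _ _ _ _ _ (fun h => \int[P]_w h w) (id : Omega -> Ft t)).
    exact: bint_prob.
  exact: measurable_id_Omega.
- exact: cyl_setIP.
- exact: cyl_setT.
- move=> A cA; have mA := measurable_cyl cA.
  rewrite !Rintegral_indic// setIT indE// fineM ?fin_num_measure// mulrC//.
Qed.

End Independence.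
End Filtration.

(** * Inner products and Young's inequality *)

Section VectorAlgebra.
Context {R : realType} (d : nat).
Implicit Types u v : 'rV[R]_d.

Lemma dotvC u v : dotv u v = dotv v u.
Proof. by apply: eq_bigr => i _; rewrite mulrC. Qed.

Lemma dotvDl u u' v : dotv (u + u') v = dotv u v + dotv u' v.
Proof. by rewrite /dotv -big_split; apply: eq_bigr => i _; rewrite mxE mulrDl. Qed.

Lemma dotvZl a u v : dotv (a *: u) v = a * dotv u v.
Proof. by rewrite /dotv mulr_sumr; apply: eq_bigr => i _; rewrite mxE mulrA. Qed.

Lemma dotvDr u v v' : dotv u (v + v') = dotv u v + dotv u v'.
Proof. by rewrite dotvC dotvDl !(dotvC u). Qed.

Lemma dotvZr a u v : dotv u (a *: v) = a * dotv u v.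
Proof. by rewrite dotvC dotvZl dotvC. Qed.

Lemma dotvNr u v : dotv u (- v) = - dotv u v.
Proof. by rewrite -scaleN1r dotvZr mulN1r. Qed.

Lemma dotvBr u v v' : dotv u (v - v') = dotv u v - dotv u v'.
Proof. by rewrite dotvDr dotvNr. Qed.

Lemma dotvBl u u' v : dotv (u - u') v = dotv u v - dotv u' v.
Proof. by rewrite !(dotvC _ v) dotvBr. Qed.

Lemma dotv_sumr (I : Type) (r : seq I) u (v : I -> 'rV[R]_d) :
  dotv u (\sum_(i <- r) v i) = \sum_(i <- r) dotv u (v i).
Proof.
elim: r => [|i r IH]; last by rewrite !big_cons dotvDr IH.
by rewrite !big_nil -(scale0r 0) dotvZr mul0r.
Qed.

Lemma sqnorm_ge0 u : 0 <= sqnorm u.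
Proof. by apply: sumr_ge0 => i _; rewrite -expr2 sqr_ge0. Qed.

Lemma sqnormZ a u : sqnorm (a *: u) = a ^+ 2 * sqnorm u.
Proof. by rewrite /sqnorm dotvZl dotvZr mulrA. Qed.

Lemma sqnormN u : sqnorm (- u) = sqnorm u.
Proof. by rewrite -scaleN1r sqnormZ sqrrN expr1n mul1r. Qed.

Lemma sqnormD_le u v : sqnorm (u + v) <= 2 * sqnorm u + 2 * sqnorm v.
Proof.
rewrite /sqnorm /dotv !mulr_sumr -big_split; apply: ler_sum => i _.
rewrite !mxE /=; have := sqr_ge0 (u 0 i - v 0 i); nra.
Qed.

(** Young's inequality in each coordinate. The free weight later splits the bias between the
    gradient and the noise. *)
Lemma dotv_weighted_le (eta : R) u v : 0 < eta ->
  `|dotv u v| <= eta / 2 * sqnorm u + (2 * eta)^-1 * sqnorm v.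
Proof.
move=> eta0; rewrite (le_trans (ler_norm_sum _ _ _))//.
rewrite /sqnorm /dotv !mulr_sumr -big_split; apply: ler_sum => i _ /=.
rewrite normrM -!expr2 -[u 0 i ^+ 2]real_normK ?num_real//.
rewrite -[v 0 i ^+ 2]real_normK ?num_real//.
set x := `|u 0 i|; set y := `|v 0 i|.
have -> : eta / 2 * x ^+ 2 + (2 * eta)^-1 * y ^+ 2 =
   x * y + (2 * eta)^-1 * (eta * x - y) ^+ 2 by field; rewrite gt_eqF.
by rewrite lerDl mulr_ge0 ?sqr_ge0// invr_ge0 mulr_ge0// ltW.
Qed.

Lemma dotv_le u v : `|dotv u v| <= (sqnorm u + sqnorm v) / 2.
Proof.
have := dotv_weighted_le u v ltr01.
by rewrite mulr1 mul1r -mulrDr mulrC.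
Qed.

Lemma coord_le_sqnorm u i : `|u 0 i| <= 1 + sqnorm u.
Proof.
apply: (@le_trans _ _ (1 + u 0 i * u 0 i)).
  by rewrite ler_norml; apply/andP; split; nra.
rewrite lerD2l /sqnorm /dotv (bigD1 i)//= lerDl.
by apply: sumr_ge0 => j _; rewrite -expr2 sqr_ge0.
Qed.

End VectorAlgebra.

(** * Functions with Lipschitz gradient *)

Section Smooth.
Context {R : realType} (d : nat).
Variables (f : 'rV[R]_d -> R) (gradf : 'rV[R]_d -> 'rV[R]_d) (L : R).
Hypotheses (L0 : 0 < L) (smooth : L_smooth f gradf L).

Lemma gradf_lipschitz x y :
  sqnorm (gradf x - gradf y) <= L ^+ 2 * sqnorm (x - y).
Proof.
have := smooth.2 x y; rewrite /enorm -ler_sqr ?nnegrE ?mulr_ge0// ?sqrtr_ge0 ?(ltW L0)//.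
by rewrite exprMn !sqr_sqrtr// sqnorm_ge0.
Qed.

Lemma gradf_bound x : sqnorm (gradf x) <= 2 * sqnorm (gradf 0) + 2 * L ^+ 2 * sqnorm x.
Proof.
have -> : gradf x = gradf 0 + (gradf x - gradf 0) by rewrite addrC subrK.
rewrite (le_trans (sqnormD_le _ _))// lerD2l -mulrA ler_pM2l//.
by have := gradf_lipschitz x 0; rewrite subr0.
Qed.

(** The mean value theorem is applied to the gap [phi] between [f] on the segment and its quadratic
    majorant. Young's inequality with weight [L c] shows that its derivative at [c] is nonpositive:
    the Lipschitz bound makes the two halves equal. *)
Lemma descent_lemma x y :
  f y <= f x + dotv (gradf x) (y - x) + L / 2 * sqnorm (y - x).
Proof.
set v := y - x.
pose phi (t : R) := f (x + t *: v) - t * dotv (gradf x) v - L / 2 * t ^+ 2 * sqnorm v.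
pose dphi (t : R) := dotv (gradf (x + t *: v) - gradf x) v - L * t * sqnorm v.
have df t : is_derive t (1 : R) (fun s : R => f (x + s *: v)) (dotv (gradf (x + t *: v)) v).
  have [fd fE] := smooth.1 (x + t *: v).
  have E : (fun h : R => h^-1 *: (((fun s : R => f (x + s *: v)) \o shift t)
        (h *: (1 : R)) - f (x + t *: v))) = (fun h : R => h^-1 *: ((f \o shift (x + t *: v)) (h *: v) - f (x + t *: v))).
    apply/funext => h /=; congr (_ *: (f _ - _)).
    by rewrite scaler1 scalerDl addrCA addrA addrC addrCA.
  have dv : derivable f (x + t *: v) v := diff_derivable fd.
  apply: DeriveDef; first by rewrite /derivable E.
  by rewrite /derive E -fE -deriveE.
have dp t : is_derive t (1 : R) phi (dphi t).
  have -> : phi = (fun s : R => f (x + s *: v)) - dotv (gradf x) v *: (id : R -> R)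
      - (L / 2 * sqnorm v) *: (id * id : R -> R).
    apply/funext => s; rewrite /phi !fctE /GRing.scale /= mulrC; congr (_ - _ - _).
    by rewrite -expr2; ring.
  apply: is_derive_eq.
  rewrite /dphi dotvBl /GRing.scale /= !mulr1.
  by field.
have cphi : {within `[0, 1], continuous phi}.
  apply: derivable_within_continuous => t _; exact: (@ex_derive _ _ _ _ _ _ _ (dp t)).
have [c c01] := @MVT_segment _ phi dphi 0 1 ler01 (fun t _ => dp t) cphi.
rewrite subr0 mulr1 => pE.
have c0 : 0 <= c by move: c01; rewrite in_itv/= => /andP[].
have : dphi c <= 0.
  rewrite /dphi subr_le0.
  have [->|cn0] := eqVneq c 0.
    by rewrite scale0r addr0 subrr mulr0 mul0r /dotv big1// => i _; rewrite mxE mul0r.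
  have Lc : 0 < L * c by rewrite mulr_gt0// lt_def cn0.
  rewrite (le_trans (ler_norm _))// dotvC (le_trans (dotv_weighted_le _ _ Lc))//.
  have := gradf_lipschitz (x + c *: v) x; rewrite addrAC subrr add0r sqnormZ => H.
  have -> : L * c * sqnorm v = L * c / 2 * sqnorm v +
      (2 * (L * c))^-1 * (L ^+ 2 * (c ^+ 2 * sqnorm v)).
    by field; rewrite cn0 gt_eqF.
  by rewrite lerD2l ler_pM2l// invr_gt0 mulr_gt0.
rewrite -pE /phi scale1r scale0r addr0 expr0n/= expr1n !mul0r !mulr0 !mul0r !subr0 mul1r mulr1.
have -> : x + v = y by rewrite /v addrC subrK.
by lra.
Qed.

End Smooth.

(** * Measurability at random points *)

Section Caratheodory.
Context {R : realType} (d : nat).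

Definition mvec dT (T : measurableType dT) (X : T -> 'rV[R]_d) :=
  forall i, measurable_fun setT (fun w => X w 0 i).

Context dT (T : measurableType dT) dS (S : measurableType dS).

(** Lattice of mesh [1 / (m + 1)], indexed by integer vectors so that a rounded point takes
    countably many values. *)
Definition grid (m : nat) (n : 'rV[int]_d) : 'rV[R]_d :=
  \row_i ((n 0 i)%:~R / m.+1%:R).

Definition cell (m : nat) (x : 'rV[R]_d) : 'rV[int]_d :=
  \row_i Num.floor (m.+1%:R * x 0 i).

Lemma cvg_grid x : grid m (cell m x) @[m --> \oo] --> x.
Proof.
apply/cvg_ballP => e e0; near=> m; split => // i j.
rewrite /ball/= ord1 !mxE distrC.
have m0 : 0 < m.+1%:R :> R by rewrite ltr0n.
have /andP[l r] := floor_itv (m.+1%:R * x 0 j).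
set n := (Num.floor _)%:~R in l *.
have r' : m.+1%:R * x 0 j < n + 1 by move: r; rewrite intrD.
have me : m.+1%:R^-1 < e.
  near: m; exact: near_infty_natSinv_lt (PosNum e0).
rewrite (le_lt_trans _ me)//.
have -> : n / m.+1%:R - x 0 j = m.+1%:R^-1 * (n - m.+1%:R * x 0 j).
  by rewrite mulrBr mulKf ?gt_eqF// mulrC.
rewrite normrM gtr0_norm ?invr_gt0// ger_pMr ?invr_gt0//.
by rewrite ler_norml; apply/andP; split; lra.
Unshelve. all: by end_near. Qed.

(** On each cell of the lattice the rounded [X] is constant, so measurability of [h] in the state is
    enough; continuity in the vector recovers [h] as the mesh tends to zero. *)
Lemma measurable_caratheodory (h : 'rV[R]_d -> S -> R) (X : T -> 'rV[R]_d) (Y : T -> S) :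
  (forall x, measurable_fun setT (h x)) -> (forall z, continuous (h^~ z)) ->
  mvec X -> measurable_fun setT Y -> measurable_fun setT (fun w => h (X w) (Y w)).
Proof.
move=> mh ch mX mY.
apply: (@measurable_fun_cvg _ _ _ setT (fun m w => h (grid m (cell m (X w))) (Y w))); last first.
  by move=> w _; apply: (@cvg_comp _ _ _ (fun m => grid m (cell m (X w)))
    (h ^~ (Y w)) _ _ _ (@cvg_grid (X w)) (ch (Y w) (X w))).
move=> m _ B mB; rewrite setTI.
rewrite [X in measurable X](_ : _ = \bigcup_(n : 'rV[int]_d)
    ((\bigcap_(i in [set: 'I_d]) [set w | Num.floor (m.+1%:R * X w 0 i) = n 0 i]) `&`
     (Y @^-1` (h (grid m n) @^-1` B)))); last first.
  apply/seteqP; split => w /=.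
    move=> hB; exists (cell m (X w)) => //; split => // i _ /=.
    by rewrite mxE.
  move=> [n _ [/= Xn hB]]; suff -> : cell m (X w) = n by [].
  by apply/rowP => i; rewrite mxE Xn.
apply: countable_bigcupT_measurable; first exact: countableP.
move=> n; apply: measurableI.
  apply: fin_bigcap_measurable; first exact: finite_finset.
  move=> i _; rewrite [X in measurable X](_ : _ =
     (fun w => m.+1%:R * X w 0 i) @^-1` `[(n 0 i)%:~R, (n 0 i + 1)%:~R[).
    rewrite -[X in measurable X]setTI.
    by apply: measurable_funM => //; exact: measurable_cst.
  apply/seteqP; split => w /=; rewrite in_itv/=.
    by move/eqP; rewrite floor_eq.
  by move=> H; apply/eqP; rewrite floor_eq.
rewrite -[X in measurable X]setTI; apply: mY => //.
by rewrite -[X in measurable X]setTI; exact: mh.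
Qed.

(** Measurability of [G] is inherited from [F]: each partial derivative is a limit of difference
    quotients, and [F], being differentiable in the vector, is continuous there. *)
Lemma measurable_gradient (F : 'rV[R]_d -> S -> R) (G : 'rV[R]_d -> S -> 'rV[R]_d)
    (X : T -> 'rV[R]_d) (Y : T -> S) :
  (forall x, measurable_fun setT (F x)) ->
  (forall x z, is_gradient (F^~ z) x (G x z)) ->
  mvec X -> measurable_fun setT Y -> mvec (fun w => G (X w) (Y w)).
Proof.
move=> mF gF mX mY i.
pose e : 'rV[R]_d := delta_mx 0 i.
pose q (n : nat) w := n.+1%:R * (F (X w + n.+1%:R^-1 *: e) (Y w) - F (X w) (Y w)).
have cF z : continuous (F ^~ z).
  by move=> x; apply: differentiable_continuous; exact: (gF x z).1.
apply: (@measurable_fun_cvg _ _ _ setT q).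
  move=> n; apply: measurable_funM => //; apply: measurable_funB.
    apply: measurable_caratheodory => // j.
    under eq_fun do rewrite mxE; apply: measurable_funD => //.
  exact: measurable_caratheodory.
move=> w _.
have [dF dE] := gF (X w) (Y w).
have -> : G (X w) (Y w) 0 i = 'D_e (F ^~ (Y w)) (X w).
  rewrite deriveE// dE /dotv (bigD1 i)//= !mxE !eqxx mulr1 big1 ?addr0// => j ji.
  by rewrite !mxE (negbTE ji) andbF mulr0.
have De : derivable (F ^~ (Y w)) (X w) e := diff_derivable dF.
have u0 : (fun n : nat => n.+1%:R^-1 : R) @ \oo --> (0 : R)^'.
  move=> A A0; have : \forall n \near \oo, (n.+1%:R^-1 : R) != 0 -> A n.+1%:R^-1.
    exact: (@cvg_harmonic R _ A0).
  by apply: filterS => n; apply; rewrite invr_neq0.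
have -> : q ^~ w = (fun h : R => h^-1 *: (((F ^~ (Y w)) \o shift (X w)) (h *: e) -
    F (X w) (Y w))) \o (fun n : nat => n.+1%:R^-1).
  by apply/funext => n; rewrite /q /= invrK /GRing.scale/= [X in F X]addrC.
exact: (cvg_comp _ _ u0 De).
Qed.

End Caratheodory.

(** * Bounded random vectors *)

Section BoundedVectors.
Context {R : realType} (d : nat).

Definition bvec dT (T : measurableType dT) (V : T -> 'rV[R]_d) : Prop :=
  forall i, bmf (fun w => V w 0 i).

Section Closure.
Context dT (T : measurableType dT).
Implicit Types U V : T -> 'rV[R]_d.

Lemma bvec_cst x : bvec (fun _ : T => x).
Proof. by move=> i; exact: bmf_cst. Qed.

Lemma bvecD U V : bvec U -> bvec V -> bvec (fun w => U w + V w).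
Proof. by move=> bU bV i; under eq_fun do rewrite mxE; exact: bmfD. Qed.

Lemma bvecZ a V : bvec V -> bvec (fun w => a *: V w).
Proof. by move=> bV i; under eq_fun do rewrite mxE; exact: bmfZ. Qed.

Lemma bvecB U V : bvec U -> bvec V -> bvec (fun w => U w - V w).
Proof.
by move=> bU bV i; under eq_fun do rewrite !mxE; exact: bmfB.
Qed.

Lemma bmf_dotv U V : bvec U -> bvec V -> bmf (fun w => dotv (U w) (V w)).
Proof. by move=> bU bV; apply: bmf_sum => i; exact: bmfM. Qed.

Lemma bmf_sqnorm V : bvec V -> bmf (fun w => sqnorm (V w)).
Proof. by move=> bV; exact: bmf_dotv. Qed.

Lemma bvec_comp dT' (T' : measurableType dT') (phi : T' -> T) V :
  measurable_fun setT phi -> bvec V -> bvec (fun w => V (phi w)).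
Proof. by move=> mphi bV i; apply: (bmf_comp mphi (bV i)). Qed.

Lemma mvec_bvec V (c : R) : mvec V -> (forall w, sqnorm (V w) <= c) -> bvec V.
Proof.
move=> mV Vc i; split; first exact: mV.
by exists (1 + c) => w; rewrite (le_trans (coord_le_sqnorm _ _))// lerD2l.
Qed.

Lemma bvec_mvec V : bvec V -> mvec V.
Proof. by move=> bV i; exact: (bV i).1. Qed.

Lemma bvec_bounded V : bvec V -> exists c : R, forall w, sqnorm (V w) <= c.
Proof.
move=> /bmf_sqnorm[_ [c hc]]; exists c => w.
exact: le_trans (ler_norm _) (hc w).
Qed.

End Closure.
End BoundedVectors.

(** * Sums of mixing coefficients *)

Section MixingSums.
Context {R : realType}.
Variable tau : nat.
Hypothesis tau0 : (0 < tau)%N.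

Definition rho (k : nat) : R := (4^-1) ^+ (k %/ tau).

Lemma rho_ge0 k : 0 <= rho k.
Proof. by rewrite exprn_ge0// invr_ge0. Qed.

(** [rho] is constant on blocks of [tau] consecutive lags, so the sum is at most [tau] times the
    geometric series of ratio [1 / 4], whose value is [4 / 3]. *)
Lemma sum_rho n : \sum_(k < n) rho k <= 4 / 3 * tau%:R.
Proof.
have block m : \sum_(0 <= k < m * tau) rho k = 4 / 3 * tau%:R * (1 - 4^-1 ^+ m).
  elim: m => [|m IH]; first by rewrite mul0n big_geq// expr0 subrr mulr0.
  rewrite (@big_cat_nat _ _ _ (m * tau)%N)//=; last by rewrite leq_mul2r leqnSn orbT.
  rewrite IH (eq_big_nat _ _ (F2 := fun=> 4^-1 ^+ m)); last first.
    move=> k /andP[k1 k2]; rewrite /rho; congr (_ ^+ _).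
    apply/eqP; rewrite eqn_leq leq_divRL// k1 andbT -ltnS ltn_divLR//.
  rewrite sumr_const_nat mulSn addnK -mulr_natr exprS; by field.
rewrite -(big_mkord xpredT rho) (@le_trans _ _ (\sum_(0 <= k < n * tau) rho k))//.
  rewrite [leRHS](@big_cat_nat _ _ _ n)//=; last by rewrite leq_pmulr.
  by rewrite lerDl sumr_ge0// => k _; exact: rho_ge0.
rewrite block ger_pMr ?mulr_gt0 ?ltr0n ?divr_gt0//.
Qed.

(** Truncated subtraction makes the maximum equal to the distance of [i] and [j]; each side of [i]
    costs one one-sided sum. *)
Lemma sum_rho_dist n (i : 'I_n) :
  \sum_(j < n) rho (maxn (i - j) (j - i)) <= 8 / 3 * tau%:R.
Proof.
have -> : 8 / 3 * tau%:R = 4 / 3 * tau%:R + 4 / 3 * tau%:R :> R by field.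
rewrite -(big_mkord xpredT (fun j => rho (maxn (i - j) (j - i)))).
rewrite (@big_cat_nat _ _ _ i)//=; last exact: ltnW.
apply: lerD.
  rewrite (le_trans _ (sum_rho i.+1))// big_ord_recl big_nat_rev /=.
  rewrite -[leLHS]add0r lerD ?rho_ge0// big_mkord ler_sum// => j _.
  suff -> : maxn (i - (0 + i - j.+1)) (0 + i - j.+1 - i) = j.+1 by [].
  by have := ltn_ord j; lia.
rewrite -{1}[val i]add0n big_addn big_mkord (le_trans _ (sum_rho (n - i)))//.
rewrite ler_sum// => j _.
by have -> : maxn (i - (j + i)) (j + i - i) = j by lia.
Qed.

End MixingSums.

(* [x = gamma L], [u = tau / b], [D = delta ^ 2], [s = sigma ^ 2], [A] the
   expected squared gradient norm and [beta] the relative bias. *)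
Lemma step_arith (R : realType) (x u D s A beta C1 : R) :
  0 < x -> 0 <= u -> 0 <= D -> 0 <= s -> 0 <= A -> 16 <= C1 ->
  beta ^+ 2 <= x * u ^+ 2 / 3 ->
  4 * x * (1 + 4 * (C1 * u + (C1 + 1) * u ^+ 2) * D) <= 1 ->
  - A + (A / 4 + beta ^+ 2 * (s + D * A)) + x * A + 64 / 3 * x * u * (s + D * A)
  <= - A / 4 + 64 / 3 * x * s * (u + u ^+ 2).
Proof.
move=> x0 u0 D0 s0 A0 hC hb hstep.
have u20 : 0 <= u ^+ 2 by rewrite sqr_ge0.
set u2 := u ^+ 2 in hb hstep u20 *.
have xD : 0 <= x * D by rewrite mulr_ge0// ltW.
have p1 : 0 <= x * D * u by rewrite mulr_ge0.
have p2 : 0 <= x * D * u2 by rewrite mulr_ge0.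
have h : 4 * x + 16 * C1 * (x * D * u) + 16 * (C1 + 1) * (x * D * u2) <= 1.
  by move: hstep; apply: le_trans; rewrite le_eqVlt; apply/orP; left; apply/eqP; ring.
have q1 : 16 * (x * D * u) <= C1 * (x * D * u) by rewrite ler_wpM2r.
have q2 : 16 * (x * D * u2) <= (C1 + 1) * (x * D * u2).
  by rewrite ler_wpM2r//; lra.
(* With [C1 >= 16] the step-size condition gives [x + 64 x D u + 64 x D u^2 <= 1 / 4]; multiplied by
   [A], this pays for every term in which [x] and [A] meet. *)
have h' : 4 * x + 256 * (x * D * u) + 256 * (x * D * u2) <= 1 by lra.
have V0 : 0 <= s + D * A by rewrite addr_ge0// mulr_ge0.
have hb' : beta ^+ 2 * (s + D * A) <= x * u2 / 3 * (s + D * A) by rewrite ler_wpM2r.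
have r : (4 * x + 256 * (x * D * u) + 256 * (x * D * u2)) * A <= A.
  by rewrite -[leRHS]mul1r ler_wpM2r.
have xA : 0 <= x * A by rewrite mulr_ge0// ltW.
have t1 : 0 <= x * D * u * A by rewrite mulr_ge0.
have t2 : 0 <= x * D * u2 * A by rewrite mulr_ge0.
have t3 : 0 <= x * u2 * s by rewrite !mulr_ge0// ltW.
have -> : 64 / 3 * x * u * (s + D * A) = 64 / 3 * (x * u * s) + 64 / 3 * (x * D * u * A) by ring.
have -> : 64 / 3 * x * s * (u + u2) = 64 / 3 * (x * u * s) + 64 / 3 * (x * u2 * s) by ring.
have e : x * u2 / 3 * (s + D * A) = (x * u2 * s + x * D * u2 * A) / 3 by ring.
have r' : 4 * (x * A) + 256 * (x * D * u * A) + 256 * (x * D * u2 * A) <= A.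
  by move: r; apply: le_trans; rewrite le_eqVlt; apply/orP; left; apply/eqP; ring.
lra.
Qed.

(** * Bias, variance and one-step decrease from a deterministic time *)

Section SecondMoment.
Context {R : realType} (d : nat) (dS dO : measure_display)
  (S : measurableType dS) (Omega : measurableType dO).
Variables (P : probability Omega R) (mu : probability S R) (Q : R.-pker S ~> S).
Variables (Z : nat -> Omega -> S) (tau : nat).
Variables (F : 'rV[R]_d -> S -> R) (G : 'rV[R]_d -> S -> 'rV[R]_d)
  (f : 'rV[R]_d -> R) (gradf : 'rV[R]_d -> 'rV[R]_d) (L sigma delta fstar : R).
Hypothesis mF : forall x, measurable_fun setT (F x).
Hypothesis gF : forall x z, is_gradient (F^~ z) x (G x z).
Hypothesis L0 : 0 < L.
Hypothesis smooth : L_smooth f gradf L.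
Hypothesis fmin : forall x, fstar <= f x.
Hypothesis mean0 : forall x i, \int[mu]_z G x z 0 i = gradf x 0 i.
Hypothesis noise : forall x z,
  sqnorm (G x z - gradf x) <= sigma ^+ 2 + delta ^+ 2 * sqnorm (gradf x).

Definition vbound (x : 'rV[R]_d) : R := sigma ^+ 2 + delta ^+ 2 * sqnorm (gradf x).

Definition dev (x : 'rV[R]_d) (z : S) : 'rV[R]_d := G x z - gradf x.

Lemma vbound_ge0 x : 0 <= vbound x.
Proof. by rewrite addr_ge0 ?sqr_ge0// mulr_ge0 ?sqr_ge0// sqnorm_ge0. Qed.

Section Boundedness.
Context dT (T : measurableType dT).
Variables (X : T -> 'rV[R]_d) (Y : T -> S).
Hypotheses (bX : bvec X) (mY : measurable_fun setT Y).

Lemma bvec_gradf : bvec (fun w => gradf (X w)).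
Proof.
have [c hc] := bvec_bounded bX.
apply: (@mvec_bvec _ _ _ _ _ (2 * sqnorm (gradf 0) + 2 * L ^+ 2 * c)); last first.
  move=> w; rewrite (le_trans (gradf_bound L0 smooth _))// lerD2l.
  by rewrite ler_wpM2l// mulr_ge0 ?sqr_ge0.
apply: (@measurable_gradient R d _ T _ T (fun x _ => f x) (fun x _ => gradf x) X id) => //.
- by move=> x z; exact: smooth.1.
- exact: bvec_mvec.
Qed.

Lemma bmf_vbound : bmf (fun w => vbound (X w)).
Proof. by apply: bmfD; [exact: bmf_cst|apply/bmfZ/bmf_sqnorm/bvec_gradf]. Qed.

Lemma bvec_dev : bvec (fun w => dev (X w) (Y w)).
Proof.
have [c hc] := bmf_vbound.2.
apply: (@mvec_bvec _ _ _ _ _ c); last first.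
  by move=> w; rewrite (le_trans (noise _ _))// (le_trans (ler_norm _) (hc w)).
move=> i; under eq_fun do rewrite !mxE; apply: measurable_funB.
  exact: (measurable_gradient mF gF (bvec_mvec bX) mY).
exact: (bvec_gradf i).1.
Qed.

Lemma bvec_G : bvec (fun w => G (X w) (Y w)).
Proof.
have -> : (fun w => G (X w) (Y w)) = (fun w => dev (X w) (Y w) + gradf (X w)).
  by apply/funext => w; rewrite subrK.
by apply: bvecD; [exact: bvec_dev|exact: bvec_gradf].
Qed.

(** The upper bound is the descent lemma started at the origin; the lower bound is [fstar]. *)
Lemma bmf_f : bmf (fun w => f (X w)).
Proof.
split.
  apply: (@measurable_caratheodory R d _ T _ T (fun x _ => f x) X id) => //.
  - by move=> z x; apply: differentiable_continuous; exact: (smooth.1 x).1.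
  - exact: bvec_mvec.
have [c hc] := bvec_bounded bX.
pose u := f 0 + (sqnorm (gradf 0) + c) / 2 + L / 2 * c.
have fu w : f (X w) <= u.
  rewrite (le_trans (descent_lemma L0 smooth 0 (X w)))// subr0.
  rewrite lerD ?lerD2l ?ler_wpM2l ?divr_ge0 ?(ltW L0)//.
  rewrite (le_trans (ler_norm _))// (le_trans (dotv_le _ _))//.
  by rewrite ler_pM2r ?invr_gt0// lerD2l.
exists (`|u| + `|fstar|) => w; rewrite ler_norml; apply/andP; split.
  rewrite opprD (le_trans _ (fmin _))// lerBlDr.
  by have := ler_norm (- fstar); rewrite normrN; have := normr_ge0 u; lra.
by rewrite (le_trans (fu w))// (le_trans (ler_norm _))// lerDl.
Qed.

End Boundedness.

Lemma dev_mean0 x u : \int[mu]_y dotv u (dev x y) = 0.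
Proof.
have bm := bint_prob mu.
have bG : bvec (fun y => G x y).
  by apply: (@bvec_G _ S (fun=> x) id) => //; exact: bvec_cst.
rewrite /dotv (bint_sum bm); last first.
  by move=> i; apply: bmfZ; under eq_fun do rewrite !mxE; apply: bmfB => //; exact: bmf_cst.
apply: big1 => i _; rewrite (bintZ bm); last first.
  by under eq_fun do rewrite !mxE; apply: bmfB => //; exact: bmf_cst.
under eq_Rintegral do rewrite !mxE.
rewrite (bintB bm)//; last exact: bmf_cst.
by rewrite mean0 (bint_cst bm) Rintegral1 mulr1 subrr mulr0.
Qed.

Local Notation Ft t := (g_sigma_algebraType (cyl Z t)).

Hypothesis mZ : forall i, measurable_fun setT (Z i).
Hypothesis fdd : forall n A, (forall i, measurable (A i)) ->
  P (cyl_set Z A n) = markov_fdd mu Q A n.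
Hypothesis Qmu : Q_invariant Q mu.
Hypothesis mix : forall k z z' A, measurable A ->
  (`| Qpow Q k z A - Qpow Q k z' A | <= ((4^-1) ^+ (k %/ tau))%:E)%E.
Hypothesis tau0 : (0 < tau)%N.

Lemma bvec_Ft t t' (V : Omega -> 'rV[R]_d) : (t <= t')%N ->
  bvec (V : Ft t -> _) -> bvec (V : Ft t' -> _).
Proof. by move=> tt'; apply: bvec_comp; exact: measurable_id_Ft. Qed.

Lemma bvec_Omega t (V : Omega -> 'rV[R]_d) :
  bvec (V : Ft t -> _) -> bvec V.
Proof. by apply: bvec_comp; exact: measurable_id_Omega. Qed.

Variables (t : nat) (X : Omega -> 'rV[R]_d).
Hypothesis bX : bvec (X : Ft t -> _).

Let bXO : bvec X. Proof. exact: bvec_Omega bX. Qed.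

Lemma bvec_devZ i : bvec (fun w : Omega => dev (X w) (Z i w)).
Proof. exact: bvec_dev. Qed.

(** The past is taken up to [t + i], so the first noise vector is frozen and the second has mean
    zero against it. Both have squared norm at most [vbound], hence so does their inner product. *)
Lemma pair_cov i k :
  `|\int[P]_w dotv (dev (X w) (Z (t + i) w)) (dev (X w) (Z (t + i + k) w))| <=
  2 * rho tau k * \int[P]_w vbound (X w).
Proof.
pose phi (p : Ft (t + i) * S) := dotv (dev (X p.1) (Z (t + i) p.1)) (dev (X p.1) p.2).
have bX1 : bvec (fun p : Ft (t + i) * S => X p.1).
  apply: bvec_comp; first exact: measurable_fst.
  by apply: bvec_Ft bX; exact: leq_addr.
apply: (@decorrelation R dS dO S Omega Z mZ Q mu P fdd tau Qmu mix (t + i) k phi).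
- apply: bmf_dotv; apply: bvec_dev => //.
  by apply: measurableT_comp; [exact: measurable_Z_Ft|exact: measurable_fst].
- exact: bmf_vbound.
- move=> w y; rewrite /phi /= (le_trans (dotv_le _ _))//.
  rewrite ler_pdivrMr// mulr_natr mulr2n.
  by apply: lerD; exact: noise.
- by move=> w; exact: (dev_mean0 (X w) (dev (X w) (Z (t + i) w))).
Qed.

Lemma grad_cov (eta : R) k : 0 < eta ->
  `|\int[P]_w dotv (gradf (X w)) (dev (X w) (Z (t + k) w))| <=
  2 * rho tau k * \int[P]_w (eta / 2 * sqnorm (gradf (X w)) + (2 * eta)^-1 * vbound (X w)).
Proof.
move=> eta0.
pose phi (p : Ft t * S) := dotv (gradf (X p.1)) (dev (X p.1) p.2).
have bX1 : bvec (fun p : Ft t * S => X p.1).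
  by apply: bvec_comp bX; exact: measurable_fst.
apply: (@decorrelation R dS dO S Omega Z mZ Q mu P fdd tau Qmu mix t k phi).
- apply: bmf_dotv; first exact: bvec_gradf.
  by apply: bvec_dev => //; exact: measurable_snd.
- apply: bmfD; apply: bmfZ; last exact: bmf_vbound.
  exact/bmf_sqnorm/bvec_gradf.
- move=> w y; rewrite /phi /= (le_trans (dotv_weighted_le _ _ eta0))//.
  by rewrite lerD2l ler_wpM2l ?noise// invr_ge0 mulr_ge0// ltW.
- by move=> w; exact: (dev_mean0 (X w) (gradf (X w))).
Qed.

(** Each row of the covariance matrix sums to at most [2 (8 / 3) tau] times the mean of [vbound].
    General weights cover both a batch average and the signed difference of two nested batches. *)
Lemma second_moment (a : nat -> R) (alpha : R) n : (forall i, `|a i| <= alpha) ->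
  \int[P]_w sqnorm (\sum_(i < n) a i *: dev (X w) (Z (t + i.+1)%N w)) <=
  16 / 3 * tau%:R * n%:R * alpha ^+ 2 * \int[P]_w vbound (X w).
Proof.
move=> ha; have bP := bint_prob P.
set V := \int[P]_w vbound (X w).
have V0 : 0 <= V by apply: Rintegral_ge0 => w _; exact: vbound_ge0.
pose c i j w := dotv (dev (X w) (Z (t + i.+1)%N w)) (dev (X w) (Z (t + j.+1)%N w)).
have bc i j : bmf (c i j) by apply: bmf_dotv; exact: bvec_devZ.
have alpha0 : 0 <= alpha by rewrite (le_trans _ (ha 0%N)).
have cov i j : `|\int[P]_w c i j w| <= 2 * rho tau (maxn (i - j) (j - i)) * V.
  have cov' m k : (m <= k)%N -> `|\int[P]_w c m k w| <= 2 * rho tau (k - m) * V.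
    move=> mk; have := pair_cov m.+1 (k - m).
    by rewrite -addnA addSn subnKC.
  have [ij|/ltnW ji] := leqP i j.
    by rewrite (_ : maxn _ _ = j - i)%N ?cov'//; lia.
  rewrite (_ : maxn _ _ = i - j)%N; last lia.
  have -> : \int[P]_w c i j w = \int[P]_w c j i w.
    by congr Rintegral; apply/funext => w; exact: dotvC.
  exact: cov'.
have -> : \int[P]_w sqnorm (\sum_(i < n) a i *: dev (X w) (Z (t + i.+1)%N w)) =
    \sum_(i < n) \sum_(j < n) a i * a j * \int[P]_w c i j w.
  transitivity (\int[P]_w (\sum_(i < n) \sum_(j < n) a i * a j * c i j w)).
    congr Rintegral; apply/funext => w; rewrite /sqnorm dotv_sumr.
    apply: eq_bigr => i _; rewrite dotvC dotv_sumr; apply: eq_bigr => j _.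
    by rewrite dotvZl dotvZr mulrA.
  rewrite (bint_sum bP); last by move=> i; apply: bmf_sum => j; exact: bmfZ.
  apply: eq_bigr => i _; rewrite (bint_sum bP); last by move=> j; exact: bmfZ.
  by apply: eq_bigr => j _; rewrite (bintZ bP).
apply: (@le_trans _ _ (\sum_(i < n) alpha ^+ 2 * 2 * V * (8 / 3 * tau%:R))).
  apply: ler_sum => i _.
  apply: (@le_trans _ _ (\sum_(j < n) alpha ^+ 2 * 2 * V * rho tau (maxn (i - j) (j - i)))).
    apply: ler_sum => j _; rewrite (le_trans (ler_norm _))// !normrM.
    have -> : alpha ^+ 2 * 2 * V * rho tau (maxn (i - j) (j - i)) =
      alpha * alpha * (2 * rho tau (maxn (i - j) (j - i)) * V) by ring.
    by rewrite ler_pM ?mulr_ge0 ?normr_ge0// ler_pM.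
  rewrite -mulr_sumr ler_wpM2l ?sum_rho_dist//.
  by rewrite !mulr_ge0 ?sqr_ge0.
by rewrite sumr_const card_ord -mulr_natr le_eqVlt; apply/orP; left; apply/eqP; field.
Qed.

(** The correlation of the gradient with a sample decays along the batch, so its sum stays bounded
    by a multiple of [tau] for every [n], and averaging leaves the factor [tau / n]. *)
Lemma bias (eta : R) n : 0 < eta -> (0 < n)%N ->
  `|\int[P]_w dotv (gradf (X w)) (\sum_(i < n) n%:R^-1 *: dev (X w) (Z (t + i.+1)%N w))| <=
  8 / 3 * tau%:R / n%:R *
  \int[P]_w (eta / 2 * sqnorm (gradf (X w)) + (2 * eta)^-1 * vbound (X w)).
Proof.
move=> eta0 n0; have bP := bint_prob P.
set V := \int[P]_w (eta / 2 * _ + _).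
have V0 : 0 <= V.
  apply: Rintegral_ge0 => w _; rewrite addr_ge0// mulr_ge0 ?sqnorm_ge0 ?vbound_ge0//.
    by rewrite divr_ge0 ?(ltW eta0).
  by rewrite invr_ge0 mulr_ge0 ?(ltW eta0).
have bg : bvec (fun w : Omega => gradf (X w)) by exact: bvec_gradf.
have bt i : bmf (fun w : Omega => dotv (gradf (X w)) (dev (X w) (Z (t + i.+1)%N w))).
  by apply: bmf_dotv => //; exact: bvec_devZ.
have -> : \int[P]_w dotv (gradf (X w)) (\sum_(i < n) n%:R^-1 *: dev (X w) (Z (t + i.+1)%N w)) =
  n%:R^-1 * \sum_(i < n) \int[P]_w dotv (gradf (X w)) (dev (X w) (Z (t + i.+1)%N w)).
  rewrite -(bint_sum bP)// -(bintZ bP); last exact: bmf_sum.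
  congr Rintegral; apply/funext => w; rewrite dotv_sumr mulr_sumr.
  by apply: eq_bigr => i _; rewrite dotvZr.
have -> : 8 / 3 * tau%:R / n%:R * V = n%:R^-1 * (2 * V * (4 / 3 * tau%:R)) by field; rewrite pnatr_eq0 -lt0n.
rewrite normrM ger0_norm ?invr_ge0// ler_pM2l ?invr_gt0 ?ltr0n//.
rewrite (le_trans (ler_norm_sum _ _ _))//.
(* The batch begins one step after the last state that [X] may depend on, so the lags start at 1;
   the lag 0 is added below to complete the series. *)
apply: (@le_trans _ _ (\sum_(i < n) 2 * V * rho tau i.+1)).
  by apply: ler_sum => i _; rewrite (le_trans (grad_cov _ eta0))// mulrAC.
rewrite -mulr_sumr ler_wpM2l ?mulr_ge0//.
by rewrite (le_trans _ (sum_rho tau0 n.+1))// big_ord_recl lerDr rho_ge0.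
Qed.

Variables (B : nat) (gamma M : R).
Hypothesis B0 : (0 < B)%N.

Lemma batch_size_gt0 j : (0 < 2 ^ j * B)%N.
Proof. by rewrite muln_gt0 expn_gt0. Qed.

Lemma bvec_gbatch j t' : (t + 2 ^ j * B <= t')%N ->
  bvec (fun w : Ft t' => gbatch G Z B (X w) t j w).
Proof.
move=> tt'; apply: bvecZ; rewrite /index_iota subSS subn0.
suff bsum s : {in s, forall i, (i <= 2 ^ j * B)%N} ->
    bvec (fun w : Ft t' => \sum_(i <- s) G (X w) (Z (t + i) w)).
  by apply: bsum => i; rewrite mem_iota add1n ltnS => /andP[].
elim: s => [_|i s IH hs].
  by under eq_fun do rewrite big_nil; exact: bvec_cst.
under eq_fun do rewrite big_cons; apply: bvecD.
  apply: bvec_G; first by apply: bvec_Ft bX; rewrite (leq_trans (leq_addr _ _) tt').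
  apply: measurable_Z_Ft; rewrite (leq_trans _ tt')// leq_add2l.
  by apply: hs; rewrite mem_head.
by apply: IH => k ks; apply: hs; rewrite inE ks orbT.
Qed.

Lemma gbatch_dev j w : gbatch G Z B (X w) t j w - gradf (X w) =
  \sum_(i < 2 ^ j * B) (2 ^ j * B)%:R^-1 *: dev (X w) (Z (t + i.+1)%N w).
Proof.
rewrite /gbatch; set n := (2 ^ j * B)%N.
have n0 : n%:R != 0 :> R by rewrite pnatr_eq0 -lt0n batch_size_gt0.
rewrite big_add1 big_mkord -scaler_sumr.
under [in RHS]eq_bigr do rewrite /dev.
by rewrite sumrB sumr_const card_ord scalerBr -[gradf _ *+ _]scaler_nat scalerA
  mulVf// scale1r.
Qed.

(** The smaller batch is the first half of the larger one: the gradients cancel, and since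
    [1 / (2 n) - 1 / n = - 1 / (2 n)] the weights have constant modulus and only change sign. *)
Lemma gbatch_diff j w : (0 < j)%N ->
  gbatch G Z B (X w) t j w - gbatch G Z B (X w) t j.-1 w =
  \sum_(i < 2 ^ j * B) ((2 ^ j * B)%:R^-1 *
     (if (i < 2 ^ j.-1 * B)%N then -1 else 1)) *: dev (X w) (Z (t + i.+1)%N w).
Proof.
move=> j0; have -> : gbatch G Z B (X w) t j w - gbatch G Z B (X w) t j.-1 w =
  (gbatch G Z B (X w) t j w - gradf (X w)) -
  (gbatch G Z B (X w) t j.-1 w - gradf (X w)).
  by rewrite opprB addrA subrK.
rewrite !gbatch_dev; set n := (2 ^ j.-1 * B)%N.
have jn : (2 ^ j * B = 2 * n)%N by rewrite -{1}(prednK j0) expnS mulnA.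
have n0 : n%:R != 0 :> R by rewrite pnatr_eq0 -lt0n batch_size_gt0.
have nn : (n <= 2 ^ j * B)%N by rewrite jn leq_pmull.
rewrite (big_ord_widen _ (fun i => n%:R^-1 *: dev (X w) (Z (t + i.+1)%N w)) nn).
rewrite [X in _ - X]big_mkcond -sumrB; apply: eq_bigr => i _.
case: ifP => _; last by rewrite subr0 mulr1.
by rewrite -scalerBl; congr (_ *: _); rewrite jn natrM; field.
Qed.

Lemma gbatch_variance j :
  \int[P]_w sqnorm (gbatch G Z B (X w) t j w - gradf (X w)) <=
  16 / 3 * tau%:R / (2 ^ j * B)%:R * \int[P]_w vbound (X w).
Proof.
under eq_Rintegral do rewrite gbatch_dev.
set n := (2 ^ j * B)%N.
have n0 : 0 < n%:R :> R by rewrite ltr0n batch_size_gt0.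
have := @second_moment (fun=> n%:R^-1) n%:R^-1 n.
move=> /(_ _)/le_trans; apply; first by move=> _; rewrite ger0_norm// invr_ge0.
rewrite le_eqVlt; apply/orP; left; apply/eqP; field.
by rewrite gt_eqF.
Qed.

Lemma gbatch_diff_variance j : (0 < j)%N ->
  \int[P]_w sqnorm (gbatch G Z B (X w) t j w - gbatch G Z B (X w) t j.-1 w) <=
  16 / 3 * tau%:R / (2 ^ j * B)%:R * \int[P]_w vbound (X w).
Proof.
move=> j0; under eq_Rintegral do rewrite gbatch_diff//.
set n := (2 ^ j * B)%N.
have n0 : 0 < n%:R :> R by rewrite ltr0n batch_size_gt0.
pose a (i : nat) : R := n%:R^-1 * (if (i < 2 ^ j.-1 * B)%N then -1 else 1).
have := @second_moment a n%:R^-1 n.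
move=> /(_ _)/le_trans; apply.
  move=> i; rewrite normrM ger0_norm ?invr_ge0//.
  by case: ifP; rewrite ?normrN normr1 mulr1.
rewrite le_eqVlt; apply/orP; left; apply/eqP; field.
by rewrite gt_eqF.
Qed.

Definition glevel (i : nat) (w : Omega) : 'rV[R]_d :=
  gest G Z (fun _ _ => i) M B 0 (X w) t w.

(** Since [0.-1] is [0], the correction vanishes at level 0, a value of probability zero for [J], so
    this level can stand for the truncated estimator. *)
Lemma glevel0 w : glevel 0 w = gbatch G Z B (X w) t 0 w.
Proof. by rewrite /glevel /gest /= subrr scaler0 addr0; case: ifP. Qed.

Lemma glevelE i w : (2 ^ i)%:R <= M -> glevel i w = gbatch G Z B (X w) t 0 w +
  (2 ^ i)%:R *: (gbatch G Z B (X w) t i w - gbatch G Z B (X w) t i.-1 w).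
Proof. by rewrite /glevel /gest => ->. Qed.

Lemma glevel_trunc i w : M < (2 ^ i)%:R -> glevel i w = gbatch G Z B (X w) t 0 w.
Proof. by rewrite /glevel /gest ltNge => /negbTE ->. Qed.

Lemma bvec_glevel i : bvec (fun w : Ft (t + 2 ^ i * B) => glevel i w).
Proof.
have le2 k : (k <= i)%N -> (t + 2 ^ k * B <= t + 2 ^ i * B)%N.
  by move=> ki; rewrite leq_add2l leq_mul2r leq_exp2l ?ki ?orbT.
have [iM|iM] := leP (2 ^ i)%:R M.
  under eq_fun do rewrite glevelE//.
  apply: bvecD; first by apply: bvec_gbatch; exact: le2.
  apply: bvecZ; apply: bvecB; apply: bvec_gbatch; apply: le2 => //.
  exact: leq_pred.
by under eq_fun do rewrite glevel_trunc//; apply: bvec_gbatch; exact: le2.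
Qed.

Variable m : nat.
Hypotheses (mM : (2 ^ m)%:R <= M) (Mm : M < (2 ^ m.+1)%:R).

(* Averages over the level [j]: weight [2 ^- i] on each [1 <= i <= m] and the
   remaining mass [2 ^- m] on the plain batch, which is level [0]. *)
Definition levels (h : nat -> R) : R :=
  h 0%N + \sum_(i < m) 2^-1 ^+ i.+1 * (h i.+1 - h 0%N).

Lemma sum_half n : \sum_(i < n) (2^-1 : R) ^+ i.+1 = 1 - 2^-1 ^+ n.
Proof.
elim: n => [|n IH]; first by rewrite big_ord0 expr0 subrr.
by rewrite big_ord_recr /= IH exprS; field.
Qed.

Lemma levelsE h :
  levels h = 2^-1 ^+ m * h 0%N + \sum_(i < m) 2^-1 ^+ i.+1 * h i.+1.
Proof.
rewrite /levels; under eq_bigr do rewrite mulrBr.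
by rewrite sumrB -mulr_suml sum_half; ring.
Qed.

Lemma levels_le h h' : (forall i, (i <= m)%N -> h i <= h' i) ->
  levels h <= levels h'.
Proof.
move=> hh'; rewrite !levelsE lerD//.
  by rewrite ler_wpM2l ?hh'// exprn_ge0 ?invr_ge0.
by apply: ler_sum => i _; rewrite ler_wpM2l ?hh' ?exprn_ge0 ?invr_ge0.
Qed.

Lemma levelsD h h' : levels (fun i => h i + h' i) = levels h + levels h'.
Proof.
rewrite !levelsE mulrDr; under eq_bigr do rewrite mulrDr.
by rewrite big_split /=; ring.
Qed.

Lemma levelsZ a h : levels (fun i => a * h i) = a * levels h.
Proof.
rewrite !levelsE mulrDr mulr_sumr mulrCA; congr (_ + _).
by apply: eq_bigr => i _; rewrite mulrCA.
Qed.

Lemma levels_cst c : levels (fun=> c) = c.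
Proof.
rewrite /levels subrr; under eq_bigr do rewrite mulr0.
by rewrite sumr_const mul0rn addr0.
Qed.

(** The probability [2^-i] of level [i] cancels the factor [2^i] of the correction. *)
Lemma levels_telescope (u : R) (v : nat -> R) :
  levels (fun i => u + 2 ^+ i * (v i - v i.-1)) = u + v m - v 0%N.
Proof.
rewrite /levels /= subrr mulr0 addr0 -addrA; congr (_ + _).
rewrite -(telescope_sumr v (leq0n m)) big_mkord; apply: eq_bigr => i _.
by rewrite addrAC subrr add0r mulrA -exprMn mulVf// expr1n mul1r.
Qed.

Let le_m i : (i <= m)%N -> (2 ^ i)%:R <= M.
Proof. by move=> im; rewrite (le_trans _ mM)// ler_nat leq_exp2l. Qed.

Lemma levels_dotv :
  levels (fun i => \int[P]_w dotv (gradf (X w)) (glevel i w)) =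
  \int[P]_w dotv (gradf (X w)) (gbatch G Z B (X w) t m w).
Proof.
have bP := bint_prob P.
have bg : bvec (fun w : Omega => gradf (X w)) by exact: bvec_gradf.
have bgb i : bvec (fun w : Omega => gbatch G Z B (X w) t i w).
  by apply: (@bvec_Omega (t + 2 ^ i * B)); exact: bvec_gbatch.
pose v i := \int[P]_w dotv (gradf (X w)) (gbatch G Z B (X w) t i w).
have E i : (i <= m)%N -> \int[P]_w dotv (gradf (X w)) (glevel i w) =
    v 0%N + 2 ^+ i * (v i - v i.-1).
  move=> im; rewrite /v -(bintB bP); [|exact: bmf_dotv..].
  rewrite -(bintZ bP); last by apply: bmfB; exact: bmf_dotv.
  rewrite -(bintD bP); [|exact: bmf_dotv|]; last first.
    by apply: bmfZ; apply: bmfB; exact: bmf_dotv.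
  congr Rintegral; apply/funext => w.
  by rewrite glevelE ?le_m// dotvDr dotvZr dotvBr natrX.
transitivity (levels (fun i => v 0%N + 2 ^+ i * (v i - v i.-1))).
  by rewrite /levels E//; congr (_ + _); apply: eq_bigr => i _; rewrite E.
by rewrite levels_telescope addrC addKr.
Qed.

(** The estimator is the gradient plus the noise of the plain batch plus [2^i] times a batch
    difference. The last has second moment of order [4^i tau / (2^i B)]; weighted by [2^-i], every
    level contributes the same amount, whence the factor [m + 1] once the plain batch is counted. *)
Lemma levels_sqnorm :
  levels (fun i => \int[P]_w sqnorm (glevel i w)) <=
  2 * \int[P]_w sqnorm (gradf (X w)) +
  64 / 3 * tau%:R * m.+1%:R / B%:R * \int[P]_w vbound (X w).
Proof.
have bP := bint_prob P.
set a := \int[P]_w sqnorm (gradf (X w)); set V := \int[P]_w vbound (X w).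
have bg : bvec (fun w : Omega => gradf (X w)) by exact: bvec_gradf.
have bgb i : bvec (fun w : Omega => gbatch G Z B (X w) t i w).
  by apply: (@bvec_Omega (t + 2 ^ i * B)); exact: bvec_gbatch.
have bgl i : bvec (glevel i) by exact: (bvec_Omega (bvec_glevel i)).
have B_gt0 : 0 < B%:R :> R by rewrite ltr0n.
set c : R := 16 / 3 * tau%:R / B%:R * V.
pose q i : R := if i == 0%N then 0 else 4 * 2 ^+ i * c.
have E i : (i <= m)%N -> \int[P]_w sqnorm (glevel i w) <= (2 * a + 4 * c) + q i.
  move=> im.
  pose D w := gbatch G Z B (X w) t i w - gbatch G Z B (X w) t i.-1 w.
  have bD : bvec D by exact: bvecB.
  pose e w := gbatch G Z B (X w) t 0 w - gradf (X w).
  have be : bvec e by exact: bvecB.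
  apply: (@le_trans _ _ (2 * a + 4 * \int[P]_w sqnorm (e w) +
      4 * 4 ^+ i * \int[P]_w sqnorm (D w))).
    rewrite -!(bintZ bP); try exact: bmf_sqnorm.
    rewrite -(bintD bP); try by apply: bmfZ; exact: bmf_sqnorm.
    rewrite -(bintD bP); [|by apply: bmfD; apply: bmfZ; exact: bmf_sqnorm|by apply: bmfZ; exact: bmf_sqnorm].
    apply: (bint_le bP); first exact: bmf_sqnorm.
      by do !apply: bmfD; apply: bmfZ; exact: bmf_sqnorm.
    move=> w; have -> : glevel i w = gradf (X w) + (e w + 2 ^+ i *: D w).
      by rewrite glevelE ?le_m// natrX addrA [gradf _ + _]addrC subrK.
    have := sqnormD_le (gradf (X w)) (e w + 2 ^+ i *: D w).
    have := sqnormD_le (e w) (2 ^+ i *: D w).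
    rewrite sqnormZ exprAC (_ : 2 ^+ 2 = 4 :> R); last by rewrite expr2 -natrM.
    by set x := sqnorm (_ + (_ + _)); nra.
  rewrite lerD ?lerD2l//.
    rewrite ler_pM2l//; have := gbatch_variance 0.
    by rewrite expn0 mul1n.
  rewrite /q /D; case: eqP => [->|/eqP i0] /=.
    rewrite (_ : Rintegral _ _ _ = 0) ?mulr0//.
    rewrite -[RHS](Rintegral_set0 P (fun=> 0)) /Rintegral integral_set0.
    by rewrite integral0_eq// => w _; rewrite subrr -(scale0r 0) sqnormZ expr0n mul0r.
  rewrite -[4 * 4 ^+ i * _]mulrA -[4 * 2 ^+ i * c]mulrA ler_pM2l//.
  apply: (@le_trans _ _ (4 ^+ i * (16 / 3 * tau%:R / (2 ^ i * B)%:R * V))).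
    rewrite ler_pM2l ?exprn_gt0//; apply: gbatch_diff_variance.
    by rewrite lt0n.
  rewrite natrM natrX (_ : 4 = 2 * 2 :> R); last by rewrite -natrM.
  rewrite exprMn le_eqVlt; apply/orP; left; apply/eqP; rewrite /c; field.
  by rewrite gt_eqF// expf_neq0.
rewrite (le_trans (levels_le E))// levelsD levels_cst.
have -> : levels q = \sum_(i < m) 4 * c.
  rewrite /levels /q eqxx add0r; apply: eq_bigr => i _.
  have e : 2^-1 ^+ i.+1 * 2 ^+ i.+1 = 1 :> R by rewrite -exprMn mulVf// expr1n.
  rewrite /= subr0; transitivity (2^-1 ^+ i.+1 * 2 ^+ i.+1 * (4 * c)); first by ring.
  by rewrite e mul1r.
rewrite sumr_const card_ord -[X in _ + _ + X]mulr_natr.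
rewrite le_eqVlt; apply/orP; left; apply/eqP; rewrite /c -natr1; field.
by rewrite gt_eqF.
Qed.

Variables (b : nat) (C1 : R).
Hypotheses (gamma0 : 0 < gamma) (b0 : (0 < b)%N) (bB : b%:R <= B%:R :> R)
  (mB : m.+1%:R / B%:R <= 2 / b%:R :> R) (hC1 : 16 <= C1)
  (M2 : 2 <= M) (hM : 256 / 3 / (gamma * L) <= M ^+ 2)
  (hgamma : gamma <= (4 * L * (1 + 4 * (C1 * tau%:R / b%:R +
     (C1 + 1) * tau%:R ^+ 2 / b%:R ^+ 2) * delta ^+ 2))^-1).

Lemma levels_decrease :
  levels (fun i => \int[P]_w (f (X w) - gamma * dotv (gradf (X w)) (glevel i w) +
    L * gamma ^+ 2 / 2 * sqnorm (glevel i w))) <=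
  \int[P]_w (f (X w) - gamma / 4 * sqnorm (gradf (X w)) +
    64 / 3 * L * gamma ^+ 2 * sigma ^+ 2 *
      (tau%:R / b%:R + tau%:R ^+ 2 / b%:R ^+ 2)).
Proof.
have bP := bint_prob P.
have bg : bvec (fun w : Omega => gradf (X w)) by exact: bvec_gradf.
have bgl i : bvec (glevel i) by exact: (bvec_Omega (bvec_glevel i)).
have bf : bmf (fun w => f (X w)) by exact: bmf_f.
have bn : bmf (fun w => sqnorm (gradf (X w))) by exact: bmf_sqnorm.
have bgb i : bvec (fun w : Omega => gbatch G Z B (X w) t i w).
  by apply: (@bvec_Omega (t + 2 ^ i * B)); exact: bvec_gbatch.
set K := 64 / 3 * L * _ * _ * _.
pose A := \int[P]_w sqnorm (gradf (X w)).
have A0 : 0 <= A by apply: Rintegral_ge0 => w _; exact: sqnorm_ge0.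
have -> : \int[P]_w (f (X w) - gamma / 4 * sqnorm (gradf (X w)) + K) =
    \int[P]_w f (X w) - gamma / 4 * A + K.
  rewrite (bintD bP); [|by apply: bmfB => //; exact: bmfZ|exact: bmf_cst].
  rewrite (bintB bP)//; last exact: bmfZ.
  by rewrite (bintZ bP)// (bint_cst bP) Rintegral1 mulr1.
have E i : \int[P]_w (f (X w) - gamma * dotv (gradf (X w)) (glevel i w) +
    L * gamma ^+ 2 / 2 * sqnorm (glevel i w)) =
  \int[P]_w f (X w) + (- gamma * \int[P]_w dotv (gradf (X w)) (glevel i w) +
    L * gamma ^+ 2 / 2 * \int[P]_w sqnorm (glevel i w)).
  have bd : bmf (fun w => dotv (gradf (X w)) (glevel i w)) by exact: bmf_dotv.
  have bs : bmf (fun w => sqnorm (glevel i w)) by exact: bmf_sqnorm.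
  rewrite (bintD bP); [|by apply: bmfB => //; exact: bmfZ|exact: bmfZ].
  rewrite (bintB bP)//; last exact: bmfZ.
  by rewrite !(bintZ bP)// mulNr addrA.
rewrite (funext E) levelsD levels_cst levelsD !levelsZ levels_dotv.
set W := levels _; set dm := \int[P]_w dotv _ _.
pose V := \int[P]_w vbound (X w).
have V0 : 0 <= V by apply: Rintegral_ge0 => w _; exact: vbound_ge0.
have VE : V = sigma ^+ 2 + delta ^+ 2 * A.
  rewrite /V /vbound (bintD bP); [|exact: bmf_cst|exact: bmfZ].
  by rewrite (bintZ bP)// (bint_cst bP) Rintegral1 mulr1.
have b_gt0 : 0 < b%:R :> R by rewrite ltr0n.
have B_gt0 : 0 < B%:R :> R by rewrite ltr0n.
have t_gt0 : 0 < tau%:R :> R by rewrite ltr0n.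
have n_gt0 : 0 < (2 ^ m * B)%:R :> R by rewrite ltr0n batch_size_gt0.
have M_gt0 : 0 < M by rewrite (lt_le_trans _ M2).
have hW : W <= 2 * A + 128 / 3 * (tau%:R / b%:R) * V.
  rewrite (le_trans levels_sqnorm)// lerD2l ler_wpM2r//.
  rewrite -[_ * _ / B%:R]mulrA (le_trans (ler_wpM2l _ mB))//.
  by rewrite le_eqVlt; apply/orP; left; apply/eqP; field; rewrite gt_eqF.
pose beta : R := 8 / 3 * tau%:R / (2 ^ m * B)%:R.
have beta0 : 0 < beta by rewrite divr_gt0// mulr_gt0// divr_gt0.
have hd : A - dm <= A / 4 + beta ^+ 2 * V.
  (* This Young weight turns [beta (eta / 2)] into [1 / 4] and [beta / (2 eta)] into [beta^2]. *)
  have eta0 : 0 < (2 * beta)^-1 by rewrite invr_gt0 mulr_gt0.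
  have := bias eta0 (batch_size_gt0 m); rewrite -/beta.
  have -> : \int[P]_w dotv (gradf (X w)) (\sum_(i < 2 ^ m * B)
      (2 ^ m * B)%:R^-1 *: dev (X w) (Z (t + i.+1)%N w)) = dm - A.
    rewrite /dm /A -(bintB bP)//; last exact: bmf_dotv.
    by congr Rintegral; apply/funext => w; rewrite -gbatch_dev dotvBr.
  rewrite (bintD bP); [|exact: bmfZ|by apply: bmfZ; exact: bmf_vbound].
  rewrite !(bintZ bP)//; last exact: bmf_vbound.
  rewrite distrC -/A -/V => /(le_trans (ler_norm _))/le_trans; apply.
  by rewrite le_eqVlt; apply/orP; left; apply/eqP; field; rewrite gt_eqF.
have hb2 : beta ^+ 2 <= gamma * L * (tau%:R / b%:R) ^+ 2 / 3.
  (* Here [2^m B >= M b / 2], from [M < 2^(m+1)] and [b <= B]. *)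
  have le1 : beta <= 16 / 3 * tau%:R / (M * b%:R).
    rewrite /beta ler_pdivlMr ?mulr_gt0// mulrAC ler_pdivrMr//.
    have : M * b%:R <= 2 * (2 ^ m * B)%:R.
      rewrite natrM mulrA ler_pM ?(ltW M_gt0)//.
      by rewrite -natrM -expnS ltW.
    move=> /(ler_wpM2l (ltW t_gt0)); lra.
  rewrite (le_trans (_ : _ <= (16 / 3 * tau%:R / (M * b%:R)) ^+ 2))//.
    by rewrite ler_sqr ?nnegrE ?(ltW beta0)// (le_trans (ltW beta0)).
  have gL : 0 < gamma * L by rewrite mulr_gt0.
  have M2gt : 0 < M ^+ 2 by rewrite exprn_gt0.
  have -> : (16 / 3 * tau%:R / (M * b%:R)) ^+ 2 =
     256 / 9 * (tau%:R / b%:R) ^+ 2 / M ^+ 2 by field; rewrite !gt_eqF.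
  rewrite ler_pdivrMr//.
  move: hM; rewrite ler_pdivrMr// => hM'.
  have u20 : 0 <= (tau%:R / b%:R) ^+ 2 :> R by rewrite sqr_ge0.
  have := ler_wpM2l u20 hM'; lra.
have x0 : 0 < gamma * L by rewrite mulr_gt0.
have C1_ge0 : 0 <= C1 by rewrite (le_trans _ hC1).
have u0 : 0 <= tau%:R / b%:R :> R by rewrite divr_ge0.
have D0 : 0 <= delta ^+ 2 by rewrite sqr_ge0.
have s0 : 0 <= sigma ^+ 2 by rewrite sqr_ge0.
have hst : 4 * (gamma * L) * (1 + 4 * (C1 * (tau%:R / b%:R) +
    (C1 + 1) * (tau%:R / b%:R) ^+ 2) * delta ^+ 2) <= 1.
  move: hgamma; set Y := (X in _ <= X^-1) => hY.
  have Y0 : 0 < Y.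
    rewrite mulr_gt0 ?mulr_gt0// ltr_wpDr// mulr_ge0// mulr_ge0// addr_ge0//.
      by rewrite divr_ge0// mulr_ge0.
    by rewrite divr_ge0 ?exprn_ge0// mulr_ge0 ?exprn_ge0// addr_ge0.
  move: hY; rewrite -(ler_pM2r Y0) mulVf ?gt_eqF//; apply: le_trans.
  by rewrite le_eqVlt; apply/orP; left; apply/eqP; rewrite /Y; field; rewrite gt_eqF.
have := step_arith x0 u0 D0 s0 A0 hC1 hb2 hst.
rewrite -VE => H.
have H1 := ler_wpM2l (ltW gamma0) H.
have H2 := ler_wpM2l (ltW gamma0) hd.
(* With [x = gamma L] and [u = tau / b], this weight turns [2 A] and [(128 / 3) u V] of [hW] into
   [gamma] times the terms [x A] and [(64 / 3) x u V] of [step_arith]. *)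
have c0 : 0 <= L * gamma ^+ 2 / 2 by rewrite divr_ge0// mulr_ge0 ?sqr_ge0// ltW.
have H3 := ler_wpM2l c0 hW.
have KE : K = gamma * (64 / 3 * (gamma * L) * sigma ^+ 2 *
   (tau%:R / b%:R + (tau%:R / b%:R) ^+ 2)).
  by rewrite /K; field; rewrite gt_eqF.
rewrite KE -addrA lerD2l.
move: H1 H2 H3; set u := tau%:R / b%:R; move: (beta ^+ 2) => b2.
lra.
Qed.

End SecondMoment.

(** * Partition of the probability space by the levels drawn *)

Section Prefixes.
Context {R : realType} (dO : measure_display) (Omega : measurableType dO).
Variables (P : probability Omega R) (J : nat -> Omega -> nat).
Hypothesis mJ : forall k j, measurable [set w | J k w = j].

Definition prefix (j : nat -> nat) (k : nat) : set Omega :=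
  [set w | forall i, (i < k)%N -> J i w = j i].

Lemma prefix0 j : prefix j 0 = setT.
Proof. by apply/seteqP; split. Qed.

Lemma prefixS j k i :
  prefix (fun n => if n == k then i else j n) k.+1 =
  prefix j k `&` [set w | J k w = i].
Proof.
apply/seteqP; split => w.
  move=> H; split; last by have := H k (ltnSn k); rewrite eqxx.
  by move=> n nk; have := H n (ltnW nk); rewrite ltn_eqF.
move=> [H Jk] n; rewrite ltnS leq_eqVlt => /predU1P[->|nk]; first by rewrite eqxx.
by rewrite ltn_eqF// H.
Qed.

Lemma measurable_prefix j k : measurable (prefix j k).
Proof.
elim: k => [|k IH]; first by rewrite prefix0.
have -> : prefix j k.+1 = prefix j k `&` [set w | J k w = j k].
  rewrite -prefixS; apply/seteqP; split => w H n nk; rewrite H//.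
    by case: eqP => [->|].
  by case: eqP => [->|].
exact: measurableI.
Qed.

(** The levels are released one at a time from the last to the first, so only gluing over the
    countably many values of a single level has to be justified. *)
Lemma prefix_ind (K : set Omega -> Prop) k :
  (forall j, K (prefix j k)) ->
  (forall E n, measurable E ->
    (forall i, K (E `&` [set w | J n w = i])) -> K E) -> K setT.
Proof.
move=> Kk step; suff H n : (n <= k)%N -> forall j, K (prefix j (k - n)).
  by have := H k (leqnn k) (fun=> 0%N); rewrite subnn prefix0.
elim: n => [|n IH] nk j; first by rewrite subn0.
apply: (step _ (k - n.+1)%N); first exact: measurable_prefix.
move=> i; rewrite -prefixS.
by have := IH (ltnW nk) (fun l => if l == (k - n.+1)%N then i else j l); rewrite subnSK.
Qed.

Lemma measurable_prefixwise k (Y : Omega -> R) :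
  (forall j, exists2 Y', measurable_fun setT Y' & forall w, prefix j k w -> Y w = Y' w) ->
  measurable_fun setT Y.
Proof.
move=> H _ C mC; apply: (@prefix_ind (fun E => measurable (E `&` Y @^-1` C)) k).
  move=> j; have [Y' mY' YY'] := H j.
  have -> : prefix j k `&` Y @^-1` C = prefix j k `&` Y' @^-1` C.
    by apply/seteqP; split => w [Ew] /= Cw; split => //=; rewrite ?YY'// -YY'.
  apply: measurableI; first exact: measurable_prefix.
  by rewrite -[X in measurable X]setTI; exact: mY'.
move=> E n mE En.
have -> : E `&` Y @^-1` C = \bigcup_i (E `&` [set w | J n w = i] `&` Y @^-1` C).
  apply/seteqP; split => [w [Ew Cw]|w [i _ [[Ew _] Cw]]]; last by [].
  by exists (J n w).
exact: bigcupT_measurable.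
Qed.

Lemma Rintegral_indicM E A (h : Omega -> R) :
  \int[P]_(w in E) (\1_A w * h w) = \int[P]_(w in E `&` A) h w.
Proof.
rewrite Rintegral_mkcondr; congr Rintegral; apply/funext => w.
by rewrite patchE indicE; case: (_ \in _); rewrite ?mul1r ?mul0r.
Qed.

(** Applied to the difference of two integrands, this reduces an inequality of expectations to each
    fixed sequence of levels. *)
Lemma Rintegral_prefixwise_ge0 k (D : Omega -> R) : bmf D ->
  (forall j, 0 <= \int[P]_(w in prefix j k) D w) -> 0 <= \int[P]_w D w.
Proof.
move=> bD; move/(@prefix_ind (fun E => 0 <= \int[P]_(w in E) D w) k); apply.
move=> E n mE En; have bE := bint_Rintegral mE (prob_fin P).
have [c hc] := bD.2.
(* This is [D] restricted to [J_n < N]: a finite sum over the values of [J_n], bounded uniformly and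
   eventually equal to [D] at each point. *)
pose u N w : R := \sum_(i < N) (\1_[set w' | J n w' = i] w * D w).
have b1 i : bmf (fun w => \1_[set w' | J n w' = i] w * D w).
  by apply: bmfM => //; exact: bmf_indic.
have bu N : bmf (u N) by exact: bmf_sum.
have uE N w : u N w = (J n w < N)%N%:R * D w.
  rewrite /u -mulr_suml; congr (_ * _).
  have [JN|JN] := ltnP (J n w) N.
    rewrite (bigD1 (Ordinal JN))//= big1 ?addr0; first by rewrite indicE mem_set.
    by move=> i iJ; rewrite indicE memNset//= => Ji; case/eqP: iJ; exact: val_inj.
  rewrite big1// => i _; rewrite indicE memNset//= => Ji.
  by have := ltn_ord i; rewrite -Ji ltnNge JN.
have uc N w : `|u N w| <= c.
  by rewrite uE normrM; case: (_ < _)%N; rewrite ?normr1 ?mul1r// normr0 mul0r (le_trans _ (hc w)).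
have uD w : u ^~ w @ \oo --> D w.
  apply: cvg_near_cst; near=> N; rewrite uE.
  have -> : (J n w < N)%N by near: N; exact: nbhs_infty_gt.
  by rewrite mul1r.
have cv := bint_cvg bE bu bD uc uD.
rewrite -(cvg_lim (@Rhausdorff R) cv); apply: limr_ge; first by apply/cvg_ex; eexists; exact: cv.
apply: nearW => N; rewrite (bint_sum bE)//; apply: sumr_ge0 => i _.
by rewrite Rintegral_indicM.
Unshelve. all: by end_near. Qed.

Context dS (S : measurableType dS) (Z : nat -> Omega -> S).
Hypothesis mZ : forall i, measurable_fun setT (Z i).
Local Notation Ft t := (g_sigma_algebraType (cyl Z t)).

(** Averaging over the next level, given a prefix [E] of probability [p]. The levels must be
    independent of the chain at all times, because [h i] involves the samples that level [i] is
    about to consume. *)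
Lemma Rintegral_levels (E : set Omega) (p : R) (Jk : Omega -> nat) (m : nat)
    (h : nat -> Omega -> R) (T : nat -> nat) :
  measurable E -> 0 <= p -> (forall i, measurable [set w | Jk w = i]) ->
  (forall t A, cyl Z t A -> P (A `&` E) = (P A * p%:E)%E) ->
  (forall i t A, cyl Z t A ->
    P (A `&` (E `&` [set w | Jk w = i.+1])) = (P A * (p * 2^-1 ^+ i.+1)%:E)%E) ->
  (forall i, bmf (h i : Ft (T i) -> R)) ->
  \int[P]_(w in E) (h 0%N w +
    \sum_(i < m) \1_[set w | Jk w = i.+1] w * (h i.+1 w - h 0%N w)) =
  p * levels m (fun i => \int[P]_w h i w).
Proof.
move=> mE p0 mJk iE iEJ bh.
have bE := bint_Rintegral mE (prob_fin P); have bP := bint_prob P.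
have bhO i : bmf (h i) by exact: (bmf_Omega mZ (bh i)).
have bi i : bmf (fun w => \1_[set w | Jk w = i.+1] w * (h i.+1 w - h 0%N w)).
  by apply: bmfM; [exact: bmf_indic|exact: bmfB].
rewrite (bintD bE)//; last exact: bmf_sum.
rewrite (Rintegral_indep mZ mE p0 (@iE (T 0%N)) (bh 0%N)) /levels mulrDr.
congr (_ + _); rewrite (bint_sum bE)// mulr_sumr; apply: eq_bigr => i _.
rewrite Rintegral_indicM.
have p1 : 0 <= p * 2^-1 ^+ i.+1 by rewrite mulr_ge0// exprn_ge0// invr_ge0.
have mEi : measurable (E `&` [set w | Jk w = i.+1]) by exact: measurableI.
have bhi : bmf ((fun w => h i.+1 w - h 0%N w) : Ft (maxn (T i.+1) (T 0%N)) -> R).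
  apply: bmfB; [apply: bmf_Ft (bh i.+1)|apply: bmf_Ft (bh 0%N)].
    exact: leq_maxl.
  exact: leq_maxr.
rewrite (Rintegral_indep mZ mEi p1 (@iEJ i _) bhi) (bintB bP)//.
by rewrite mulrA.
Qed.

End Prefixes.

Lemma sqnorm_le_coord (R : realType) (d : nat) (u : 'rV[R]_d) (e : R) :
  (forall l, `|u 0 l| <= e) -> sqnorm u <= d%:R * e ^+ 2.
Proof.
move=> ue; rewrite mulr_natl -[d in leRHS]card_ord -sumr_const /sqnorm /dotv.
apply: ler_sum => l _; rewrite -expr2 -real_normK ?num_real//.
by rewrite ler_sqr ?nnegrE// (le_trans _ (ue l)).
Qed.

(** * Iterates along a sequence of levels *)

Section Trajectory.
Context {R : realType} (d : nat) (S Omega : Type).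
Variables (G : 'rV[R]_d -> S -> 'rV[R]_d) (Z : nat -> Omega -> S)
  (gamma M : R) (B : nat) (x0 : 'rV[R]_d).

Lemma rgd_prefix (J : nat -> Omega -> nat) j k w :
  (forall i, (i < k)%N -> J i w = j i) ->
  rgd G Z J gamma M B x0 k w = rgd G Z (fun i _ => j i) gamma M B x0 k w.
Proof.
elim: k => //= k IH Jj; rewrite IH => [|i ik]; last by apply: Jj; exact: ltnW.
by rewrite /gest Jj.
Qed.

Fixpoint consumed (j : nat -> nat) (k : nat) : nat :=
  if k is k'.+1 then (consumed j k' + 2 ^ j k' * B)%N else 0%N.

Lemma rgd_consumed j k w :
  (rgd G Z (fun i _ => j i) gamma M B x0 k w).2 = consumed j k.
Proof. by elim: k => //= k ->. Qed.

(** The levels are unbounded, but a correction is used only when its factor [2^j] is at most [M], so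
    each step has bounded length. *)
Lemma rgd_bounded (J : nat -> Omega -> nat) k :
  (0 < B)%N ->
  (forall c : R, exists c' : R, forall x z, sqnorm x <= c -> sqnorm (G x z) <= c') ->
  exists c : R, forall w, sqnorm (rgd G Z J gamma M B x0 k w).1 <= c.
Proof.
move=> B0 Gb; elim: k => [|k [c IH]] /=; first by exists (sqnorm x0).
have [c' hc'] := Gb c.
pose e := 1 + c'.
have Ge w T i l : `|G (rgd G Z J gamma M B x0 k w).1 (Z (T + i)%N w) 0 l| <= e.
  by rewrite (le_trans (coord_le_sqnorm _ _))// lerD2l hc'.
have gbe w T j l : `|gbatch G Z B (rgd G Z J gamma M B x0 k w).1 T j w 0 l| <= e.
  rewrite /gbatch mxE normrM; set n := (2 ^ j * B)%N.
  have n0 : 0 < n%:R :> R by rewrite ltr0n muln_gt0 expn_gt0.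
  rewrite gtr0_norm ?invr_gt0// mulrC ler_pdivrMr// summxE.
  rewrite (le_trans (ler_norm_sum _ _ _))// big_add1 big_mkord.
  apply: (@le_trans _ _ (\sum_(i < n) e)); first by apply: ler_sum => i _.
  by rewrite sumr_const card_ord mulr_natr.
pose e' := e + `|M| * (e + e).
have gle w T l : `|gest G Z J M B k (rgd G Z J gamma M B x0 k w).1 T w 0 l| <= e'.
  have e0 : 0 <= e by rewrite (le_trans _ (gbe w T 0%N l)).
  rewrite /gest; case: ifP => jM.
    rewrite mxE (le_trans (ler_normD _ _))// lerD//.
    rewrite mxE normrM ler_pM//.
      by rewrite normr_nat (le_trans jM)// ler_norm.
    rewrite [X in `|X|]mxE [X in _ + X]mxE (le_trans (ler_normB _ _))//.
    by rewrite lerD ?gbe.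
  by rewrite (le_trans (gbe _ _ _ _))// lerDl mulr_ge0// addr_ge0.
exists (2 * c + 2 * (gamma ^+ 2 * (d%:R * e' ^+ 2))) => w.
rewrite (le_trans (sqnormD_le _ _))// lerD ?ler_pM2l//.
rewrite sqnormN sqnormZ ler_wpM2l ?sqr_ge0//.
exact: sqnorm_le_coord.
Qed.

End Trajectory.

(** * Expected decrease at random times and its sum *)

Section Convergence.
Context {R : realType} (d : nat) (dS dO : measure_display)
  (S : measurableType dS) (Omega : measurableType dO).
Variables (P : probability Omega R) (mu : probability S R) (Q : R.-pker S ~> S)
  (Z : nat -> Omega -> S) (J : nat -> Omega -> nat) (tau : nat)
  (F : 'rV[R]_d -> S -> R) (G : 'rV[R]_d -> S -> 'rV[R]_d)
  (f : 'rV[R]_d -> R) (gradf : 'rV[R]_d -> 'rV[R]_d) (L sigma delta fstar : R)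
  (b B m : nat) (gamma M C1 : R) (x0 : 'rV[R]_d).
Hypothesis mF : forall x, measurable_fun setT (F x).
Hypothesis gF : forall x z, is_gradient (F^~ z) x (G x z).
Hypothesis L0 : 0 < L.
Hypothesis smooth : L_smooth f gradf L.
Hypothesis fmin : forall x, fstar <= f x.
Hypothesis mean0 : forall x i, \int[mu]_z G x z 0 i = gradf x 0 i.
Hypothesis noise : forall x z,
  sqnorm (G x z - gradf x) <= sigma ^+ 2 + delta ^+ 2 * sqnorm (gradf x).
Hypothesis mZ : forall i, measurable_fun setT (Z i).
Hypothesis mJ : forall k j, measurable [set w | J k w = j].
Hypothesis joint : forall (n k : nat) (A : nat -> set S) (j : nat -> nat),
  (forall i, measurable (A i)) ->
  P (cyl_set Z A n `&` prefix J j k) =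
  (markov_fdd mu Q A n * (\prod_(i < k) geom_half R (j i))%:E)%E.
Hypothesis Qmu : Q_invariant Q mu.
Hypothesis mix : forall k z z' A, measurable A ->
  (`| Qpow Q k z A - Qpow Q k z' A | <= ((4^-1) ^+ (k %/ tau))%:E)%E.
Hypothesis tau0 : (0 < tau)%N.
Hypothesis B0 : (0 < B)%N.
Hypotheses (mM : (2 ^ m)%:R <= M) (Mm : M < (2 ^ m.+1)%:R).
Hypotheses (gamma0 : 0 < gamma) (b0 : (0 < b)%N) (bB : b%:R <= B%:R :> R)
  (mB : m.+1%:R / B%:R <= 2 / b%:R :> R) (hC1 : 16 <= C1)
  (M2 : 2 <= M) (hM : 256 / 3 / (gamma * L) <= M ^+ 2)
  (hgamma : gamma <= (4 * L * (1 + 4 * (C1 * tau%:R / b%:R +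
     (C1 + 1) * tau%:R ^+ 2 / b%:R ^+ 2) * delta ^+ 2))^-1).

Local Notation Ft t := (g_sigma_algebraType (cyl Z t)).
Local Notation x_ k w := (rgd G Z J gamma M B x0 k w).1.
Local Notation y_ j k w := (rgd G Z (fun i _ => j i) gamma M B x0 k w).1.
Local Notation time j k := (consumed B j k).

Lemma fdd_chain n A : (forall i, measurable (A i)) ->
  P (cyl_set Z A n) = markov_fdd mu Q A n.
Proof.
move=> mA; have := joint n 0 (fun=> 0%N) mA.
by rewrite prefix0 setIT big_ord0 mule1.
Qed.

Definition pprob (j : nat -> nat) (k : nat) : R := \prod_(i < k) geom_half R (j i).

Lemma geom_half_ge0 i : 0 <= geom_half R i.
Proof. by rewrite /geom_half; case: ifP => // _; rewrite exprn_ge0// invr_ge0. Qed.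

Lemma pprob_ge0 j k : 0 <= pprob j k.
Proof. by apply: prodr_ge0 => i _; exact: geom_half_ge0. Qed.

Lemma prefix_indep j k t A : cyl Z t A ->
  P (A `&` prefix J j k) = (P A * (pprob j k)%:E)%E.
Proof. by move=> [C [mC ->]]; rewrite joint// fdd_chain. Qed.

Lemma prefix_level_indep j k i t A : cyl Z t A ->
  P (A `&` (prefix J j k `&` [set w | J k w = i.+1])) =
  (P A * (pprob j k * 2^-1 ^+ i.+1)%:E)%E.
Proof.
move=> cA; rewrite -prefixS (prefix_indep _ _ cA); congr (_ * _%:E)%E.
rewrite /pprob big_ord_recr /= eqxx; congr (_ * _).
by apply: eq_bigr => l _; rewrite ltn_eqF.
Qed.

Lemma bvec_y j k : bvec (fun w : Ft (time j k) => y_ j k w).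
Proof.
elim: k => [|k IH]; first exact: bvec_cst.
have -> : (fun w => y_ j k.+1 w) = (fun w => y_ j k w -
    gamma *: glevel Z G (time j k) (fun w => y_ j k w) B M (j k) w).
  by apply/funext => w; rewrite /glevel -(rgd_consumed G Z gamma M B x0 j k w).
apply: bvecB; first by apply: bvec_Ft IH; exact: leq_addr.
by apply: bvecZ; exact: (bvec_glevel mF gF L0 smooth noise IH B M (j k)).
Qed.

Lemma x_prefix j k w : prefix J j k w -> x_ k w = y_ j k w.
Proof. by move=> pw; rewrite (rgd_prefix G Z gamma M B x0 pw). Qed.

Lemma G_bounded (c : R) : exists c' : R, forall x z, sqnorm x <= c -> sqnorm (G x z) <= c'.
Proof.
pose a := 2 * sqnorm (gradf 0) + 2 * L ^+ 2 * c.
exists (2 * (sigma ^+ 2 + delta ^+ 2 * a) + 2 * a) => x z xc.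
have ga : sqnorm (gradf x) <= a.
  rewrite (le_trans (gradf_bound L0 smooth _))// lerD2l ler_wpM2l//.
  by rewrite mulr_ge0// sqr_ge0.
have -> : G x z = (G x z - gradf x) + gradf x by rewrite subrK.
rewrite (le_trans (sqnormD_le _ _))// lerD ?ler_pM2l//.
by rewrite (le_trans (noise _ _))// lerD2l ler_wpM2l// sqr_ge0.
Qed.

(** Measurability is glued from the prefixes; bounds found prefix by prefix need not be uniform over
    infinitely many of them, so the bound comes from [rgd_bounded]. *)
Lemma bvec_x k : bvec (fun w => x_ k w).
Proof.
have [c hc] := rgd_bounded Z gamma M x0 J k B0 G_bounded.
apply: mvec_bvec hc => i; apply: (measurable_prefixwise mJ (k := k)) => j.
exists (fun w => y_ j k w 0 i); last by move=> w /x_prefix ->.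
exact: (bvec_Omega mZ (bvec_y j k) i).1.
Qed.

Let K := 64 / 3 * L * gamma ^+ 2 * sigma ^+ 2 *
  (tau%:R / b%:R + tau%:R ^+ 2 / b%:R ^+ 2).

(** On a prefix event, [x^k] is a function [X] of the past at a constant time. The descent lemma
    bounds the next value by [h (J k w) w], whose average over the next level is treated by
    [levels_decrease]. *)
Lemma expected_decrease k :
  \int[P]_w f (x_ k.+1 w) <=
  \int[P]_w (f (x_ k w) - gamma / 4 * sqnorm (gradf (x_ k w)) + K).
Proof.
have bP := bint_prob P.
have bf l : bmf (fun w => f (x_ l w)) := bmf_f L0 smooth fmin (bvec_x l).
have bg : bmf (fun w => sqnorm (gradf (x_ k w))).
  exact: (bmf_sqnorm (bvec_gradf L0 smooth (bvec_x k))).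
have bu : bmf (fun w => f (x_ k w) - gamma / 4 * sqnorm (gradf (x_ k w)) + K).
  by apply: bmfD; [apply: bmfB => //; exact: bmfZ|exact: bmf_cst].
rewrite -subr_ge0 -(bintB bP)//; apply: (Rintegral_prefixwise_ge0 mJ (k := k)).
  exact: bmfB.
move=> j; set E := prefix J j k.
have mE : measurable E by exact: measurable_prefix.
have bE := bint_Rintegral mE (prob_fin P).
rewrite (bintB bE)// subr_ge0.
pose X w := y_ j k w; pose t := time j k.
have bX : bvec (X : Ft t -> _) by exact: bvec_y.
pose h i w := f (X w) - gamma * dotv (gradf (X w)) (glevel Z G t X B M i w) +
  L * gamma ^+ 2 / 2 * sqnorm (glevel Z G t X B M i w).
pose T i := (t + 2 ^ i * B)%N.
have bXT i : bvec (X : Ft (T i) -> _) by apply: bvec_Ft bX; exact: leq_addr.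
have bh i : bmf (h i : Ft (T i) -> R).
  have bgl := bvec_glevel mF gF L0 smooth noise bX B M i.
  apply: bmfD; last by apply: bmfZ; exact: bmf_sqnorm.
  apply: bmfB; first exact: (bmf_f L0 smooth fmin (bXT i)).
  apply: bmfZ; apply: bmf_dotv bgl; exact: (bvec_gradf L0 smooth (bXT i)).
have bhO i : bmf (h i) := bmf_Omega mZ (bh i).
(* This is [h (J k w) w] written with finitely many events: all levels above [m] give the plain
   batch, hence the value [h 0]. *)
pose U w := h 0%N w + \sum_(i < m) \1_[set w | J k w = i.+1] w * (h i.+1 w - h 0%N w).
have bU : bmf U.
  apply: bmfD => //; apply: bmf_sum => i; apply: bmfM; last exact: bmfB.
  exact: bmf_indic.
have UE w : U w = h (J k w) w.
  rewrite /U; have [Jm|mJk] := leqP (J k w) m; last first.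
    rewrite big1 ?addr0; last first.
      move=> i _; rewrite indicE memNset ?mul0r//= => Ji.
      by have := ltn_ord i; rewrite -Ji leqNgt mJk.
    have Mj : M < (2 ^ J k w)%:R by rewrite (lt_le_trans Mm)// ler_nat leq_exp2l.
    by rewrite /h glevel0 glevel_trunc.
  have [J0|J0] := posnP (J k w).
    by rewrite J0 big1 ?addr0// => i _; rewrite indicE memNset ?mul0r//= J0.
  have Jm' : ((J k w).-1 < m)%N by rewrite prednK.
  rewrite (bigD1 (Ordinal Jm'))//= big1 ?addr0; last first.
    move=> i iJ; rewrite indicE memNset ?mul0r//= => Ji.
    by case/eqP: iJ; apply: val_inj; rewrite /= Ji.
  by rewrite prednK// indicE mem_set// mul1r addrC subrK.
apply: (@le_trans _ _ (\int[P]_(w in E) U w)).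
  rewrite [leLHS]Rintegral_mkcond [leRHS]Rintegral_mkcond.
  have patch_indic g : g \_ E = (fun w => \1_E w * g w) :> (Omega -> R).
    by apply/funext => w; rewrite patchE indicE; case: (_ \in _); rewrite ?mul1r ?mul0r.
  rewrite !patch_indic; apply: (bint_le bP); do ?by apply: bmfM => //; exact: bmf_indic.
  move=> w; rewrite indicE; have [Ew|_] := boolP (w \in E); last by rewrite !mul0r.
  rewrite !mul1r UE /h.
  have xE : rgd G Z J gamma M B x0 k w = (X w, t).
    rewrite (rgd_prefix G Z gamma M B x0 (set_mem Ew)) [LHS]surjective_pairing.
    by rewrite rgd_consumed.
  have -> : x_ k.+1 w = X w - gamma *: glevel Z G t X B M (J k w) w.
    by rewrite /= xE.
  rewrite (le_trans (descent_lemma L0 smooth (X w) _))//.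
  rewrite (_ : X w - _ - X w = - (gamma *: glevel Z G t X B M (J k w) w)); last first.
    by rewrite addrAC subrr add0r.
  rewrite dotvNr dotvZr sqnormN sqnormZ.
  by rewrite le_eqVlt; apply/orP; left; apply/eqP; ring.
rewrite (@Rintegral_levels R dO Omega P dS S Z mZ E (pprob j k) (J k) m h T)//; first last.
- by move=> i t' A cA; exact: (prefix_level_indep j k i cA).
- by move=> t' A cA; exact: (prefix_indep j k cA).
- exact: pprob_ge0.
pose u w := f (X w) - gamma / 4 * sqnorm (gradf (X w)) + K.
have bux : bmf (u : Ft t -> R).
  apply: bmfD; last exact: bmf_cst.
  apply: bmfB; first exact: (bmf_f L0 smooth fmin bX).
  by apply: bmfZ; apply: bmf_sqnorm; exact: (bvec_gradf L0 smooth bX).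
have -> : \int[P]_(w in E) (f (x_ k w) - gamma / 4 * sqnorm (gradf (x_ k w)) + K) =
    pprob j k * \int[P]_w u w.
  rewrite -(Rintegral_indep mZ mE (pprob_ge0 j k) (@prefix_indep j k t) bux).
  by apply: eq_Rintegral => w /set_mem Ew; rewrite (x_prefix Ew).
rewrite ler_wpM2l ?pprob_ge0//.
exact: (levels_decrease mF gF L0 smooth fmin mean0 noise mZ fdd_chain Qmu mix
  tau0 bX B0 mM Mm gamma0 b0 bB mB hC1 M2 hM hgamma).
Qed.

Lemma gradient_average_bound N : (0 < N)%N ->
  (\int[P]_w (N%:R^-1 * \sum_(k < N) sqnorm (gradf (x_ k w)))%:E <=
   (4 * (f x0 - fstar) / (gamma * N%:R) + 4 / gamma * K)%:E)%E.
Proof.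
move=> N0; have bP := bint_prob P.
have bf l : bmf (fun w => f (x_ l w)) := bmf_f L0 smooth fmin (bvec_x l).
have bg k : bmf (fun w => sqnorm (gradf (x_ k w))).
  exact: (bmf_sqnorm (bvec_gradf L0 smooth (bvec_x k))).
pose a k := \int[P]_w sqnorm (gradf (x_ k w)); pose v k := \int[P]_w f (x_ k w).
have dec k : gamma / 4 * a k <= v k - v k.+1 + K.
  have := expected_decrease k.
  rewrite (bintD bP); [|by apply: bmfB => //; exact: bmfZ|exact: bmf_cst].
  rewrite (bintB bP)//; last exact: bmfZ.
  rewrite (bintZ bP)// (bint_cst bP) Rintegral1 mulr1 -/(a k) -/(v k) -/(v k.+1).
  lra.
have vN : fstar <= v N.
  rewrite -[leLHS]mulr1 -(Rintegral1 P) -(bint_cst bP); apply: (bint_le bP) => //.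
  exact: bmf_cst.
have v0 : v 0%N = f x0 by rewrite /v /= (bint_cst bP) Rintegral1 mulr1.
have sum_dec : gamma / 4 * \sum_(k < N) a k <= f x0 - fstar + N%:R * K.
  rewrite mulr_sumr; apply: (@le_trans _ _ (\sum_(k < N) (v k - v k.+1 + K))).
    by apply: ler_sum => k _; exact: dec.
  rewrite big_split /= sumr_const card_ord -[K *+ N]mulr_natl lerD2r.
  have -> : \sum_(k < N) (v k - v k.+1) = v 0%N - v N.
    rewrite -opprB -(telescope_sumr v (leq0n N)) big_mkord -sumrN.
    by apply: eq_bigr => k _; rewrite opprB.
  by rewrite v0 lerD2l lerN2.
have bS : bmf (fun w => N%:R^-1 * \sum_(k < N) sqnorm (gradf (x_ k w))).
  by apply: bmfZ; exact: bmf_sum.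
have -> : (\int[P]_w (N%:R^-1 * \sum_(k < N) sqnorm (gradf (x_ k w)))%:E)%E =
    (N%:R^-1 * \sum_(k < N) a k)%:E.
  rewrite /a -(bint_sum bP)// -(bintZ bP); last exact: bmf_sum.
  rewrite /Rintegral fineK//; apply: integrable_fin_num => //.
  by apply: bmf_integrable => //; exact: prob_fin.
have N_gt0 : 0 < N%:R :> R by rewrite ltr0n.
rewrite lee_fin.
have c0 : 0 < 4 / (gamma * N%:R) by rewrite divr_gt0// mulr_gt0.
have := ler_wpM2l (ltW c0) sum_dec.
have -> : 4 / (gamma * N%:R) * (gamma / 4 * \sum_(k < N) a k) = N%:R^-1 * \sum_(k < N) a k.
  by field; rewrite !gt_eqF.
move=> /le_trans; apply; rewrite le_eqVlt; apply/orP; left; apply/eqP; field.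
by rewrite !gt_eqF.
Qed.

End Convergence.

(** Take [m] to be the integer part of [log_2 M]. Since [M >= 2], it is at least 1, so [B >= b m]
    gives both [B >= b] and, by [m + 1 <= 2 m], the last bound. *)
Lemma level_choice (R : realType) (M : R) (b B : nat) :
  2 <= M -> (0 < b)%N -> b%:R * (ln M / ln 2) <= B%:R ->
  exists m : nat, [/\ (2 ^ m)%:R <= M, M < (2 ^ m.+1)%:R, (0 < B)%N,
    b%:R <= B%:R :> R & m.+1%:R / B%:R <= 2 / b%:R :> R].
Proof.
move=> M2 b0 hB; have M0 : 0 <= M by rewrite (le_trans _ M2).
have T2 : (2 <= Num.trunc M)%N by rewrite truncn_ge_nat.
pose m := trunc_log 2 (Num.trunc M); exists m.
have m0 : (0 < m)%N by rewrite trunc_log_gt0.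
have mM : (2 ^ m)%:R <= M.
  rewrite (le_trans _ (_ : (Num.trunc M)%:R <= M)) ?truncn_le//.
  by rewrite ler_nat trunc_logP// (leq_trans _ T2).
have Mm : M < (2 ^ m.+1)%:R.
  by rewrite (lt_le_trans (truncnS_gt M))// ler_nat trunc_log_ltn.
have ln2 : 0 < ln (2 : R) by rewrite ln_gt0// ltr1n.
have mlog : m%:R <= ln M / ln 2.
  rewrite ler_pdivlMr// mulr_natl -lnXn// ler_ln ?posrE ?exprn_gt0//.
    by rewrite -natrX.
  by rewrite (lt_le_trans _ M2).
have b_gt0 : 0 < b%:R :> R by rewrite ltr0n.
have bmB : b%:R * m%:R <= B%:R :> R.
  by rewrite (le_trans _ hB)// ler_pM2l.
have bB : b%:R <= B%:R :> R.
  by rewrite (le_trans _ bmB)// ler_peMr ?(ltW b_gt0)// ler1n.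
have B_gt0 : 0 < B%:R :> R by rewrite (lt_le_trans b_gt0).
split => //; first by rewrite -(ltr0n R).
rewrite ler_pdivrMr// mulrAC ler_pdivlMr//.
have m1 : 1 <= m%:R :> R by rewrite ler1n.
rewrite -natr1; nra.
Qed.

Theorem theorem3 (R : realType) :
  exists C : R, 0 < C /\
  forall (d : nat)
    (dS : measure_display) (S : measurableType dS)
    (dO : measure_display) (Omega : measurableType dO)
    (P : probability Omega R) (pi : probability S R) (Q : R.-pker S ~> S)
    (Z : nat -> Omega -> S) (J : nat -> Omega -> nat) (tau : nat)
    (F : 'rV[R]_d -> S -> R) (G : 'rV[R]_d -> S -> 'rV[R]_d)
    (f : 'rV[R]_d -> R) (gradf : 'rV[R]_d -> 'rV[R]_d)
    (L sigma delta fstar : R) (b N B : nat) (gamma M : R) (x0 : 'rV[R]_d),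
  (* f = E_pi[F(., Z)] is L-smooth, with global minimum value fstar *)
  (forall x, pi.-integrable setT (fun z => (F x z)%:E)) ->
  (forall x, ((f x)%:E = \int[pi]_z (F x z)%:E)%E) ->
  (forall x z, is_gradient (fun y => F y z) x (G x z)) ->
  0 < L -> L_smooth f gradf L ->
  (forall x, fstar <= f x) -> (exists xs, f xs = fstar) ->
  (* unbiasedness and variance bound of the stochastic gradient *)
  (forall x (i : 'I_d), pi.-integrable setT (fun z => (G x z 0 i)%:E) /\
     (\int[pi]_z (G x z 0 i)%:E = (gradf x 0 i)%:E)%E) ->
  (forall x z, sqnorm (G x z - gradf x) <= sigma ^+ 2 + delta ^+ 2 * sqnorm (gradf x)) ->
  (* Markov kernel Q with unique invariant distribution pi, mixing time tau *)
  Q_invariant Q pi ->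
  (forall mu : probability S R, Q_invariant Q mu ->
     forall A, measurable A -> mu A = pi A) ->
  (0 < tau)%N ->
  (forall k z z' A, measurable A ->
     (`| Qpow Q k z A - Qpow Q k z' A | <= ((4^-1) ^+ (k %/ tau))%:E)%E) ->
  (* (Z_i) is a stationary Markov chain (Z_0 ~ pi, kernel Q); the J_k are
     i.i.d. Geom(1/2) and independent of (Z_i) *)
  (forall i, measurable_fun setT (Z i)) ->
  (forall k j, measurable [set w | J k w = j]) ->
  (forall (n m : nat) (A : nat -> set S) (j : nat -> nat),
     (forall i, measurable (A i)) ->
     (P ([set w | forall i, (i <= n)%N -> A i (Z i w)] `&`
         [set w | forall k, (k < m)%N -> J k w = j k])
      = markov_fdd pi Q A n * (\prod_(k < m) geom_half R (j k))%:E)%E) ->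
  (* parameters *)
  (0 < b)%N -> (0 < N)%N ->
  0 < gamma ->
  gamma <= (4 * L * (1 + 4 * ((16 * (1 + 1 / (ln (4 : R)) ^+ 2)) * tau%:R / b%:R
        + ((16 * (1 + 1 / (ln (4 : R)) ^+ 2)) + 1) * tau%:R ^+ 2 / b%:R ^+ 2)
        * delta ^+ 2))^-1 ->
  M = Num.max 2 (Num.sqrt ((256 / 3) / (gamma * L))) ->
  (B%:Z = Num.ceil (b%:R * (ln M / ln 2)))%R ->
  (\int[P]_w ((N%:R)^-1 *
      \sum_(k < N) sqnorm (gradf (rgd G Z J gamma M B x0 k w).1))%:E
   <= (C * ((f x0 - fstar) / (gamma * N%:R)
        + L * gamma * (sigma ^+ 2 * tau%:R / b%:R
                       + sigma ^+ 2 * tau%:R ^+ 2 / b%:R ^+ 2)))%:E)%E.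
(* The two terms of the bound come with the constants [4] and [4 (64 / 3) = 256 / 3], both below
   100. *)
exists 100; split => // d dS S dO Omega P mu Q Z J tau F G f gradf L sigma delta
  fstar b N B gamma M x0 iF _ gF L0 smooth fmin _ mean noise Qmu _ tau0 mix mZ mJ
  joint b0 N0 gamma0 hgamma ME BE.
have mF x : measurable_fun setT (F x).
  by have /integrableP[/measurable_EFinP] := iF x.
have mean0 x i : \int[mu]_z G x z 0 i = gradf x 0 i.
  by rewrite /Rintegral (mean x i).2.
have M2 : 2 <= M by rewrite ME le_max lexx.
have hM : 256 / 3 / (gamma * L) <= M ^+ 2.
  set y := 256 / 3 / (gamma * L).
  have y0 : 0 <= y by rewrite divr_ge0 ?divr_ge0// ltW// mulr_gt0.
  rewrite -[leLHS]sqr_sqrtr// ler_sqr ?nnegrE ?sqrtr_ge0//.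
    by rewrite ME le_max lexx orbT.
  by rewrite (le_trans _ M2).
have hB : b%:R * (ln M / ln 2) <= B%:R.
  by rewrite (le_trans (ceil_ge _))// -BE.
have [m [mM Mm B0 bB mB]] := level_choice M2 b0 hB.
pose C1 : R := 16 * (1 + 1 / ln 4 ^+ 2).
have hC1 : 16 <= C1.
  by rewrite /C1 ler_peMr// lerDl divr_ge0// sqr_ge0.
have := gradient_average_bound x0 mF gF L0 smooth fmin mean0 noise mZ mJ joint
  Qmu mix tau0 B0 mM Mm gamma0 b0 bB mB hC1 M2 hM hgamma N0.
move=> /le_trans; apply; rewrite lee_fin.
have gN : 0 < gamma * N%:R by rewrite mulr_gt0// ltr0n.
have f0 : 0 <= (f x0 - fstar) / (gamma * N%:R).
  by rewrite divr_ge0 ?subr_ge0// ltW.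
set u := sigma ^+ 2 * _ / _ + _.
have u0 : 0 <= L * gamma * u.
  rewrite mulr_ge0 ?mulr_ge0 ?(ltW L0) ?(ltW gamma0)//.
  have s2 : 0 <= sigma ^+ 2 by exact: sqr_ge0.
  by apply: addr_ge0; apply: divr_ge0; rewrite ?(mulr_ge0 s2) ?sqr_ge0//.
have -> : 4 / gamma * (64 / 3 * L * gamma ^+ 2 * sigma ^+ 2 *
    (tau%:R / b%:R + tau%:R ^+ 2 / b%:R ^+ 2)) = 256 / 3 * (L * gamma * u).
  by rewrite /u; field; rewrite gt_eqF ?ltr0n//= gt_eqF.
by rewrite -mulrA; lra.
Qed.
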